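(* Let $k\ge1$ be an integer and let $\nu\in\mathcal{D}_{\mathrm{alg}}(k)$. Then for every $t>0$, $$\Phi(\nu\boxplus\gamma_t)=\mathbb{B}_t(\Phi(\nu)).$$ Here $\gamma_t\in\mathcal{D}_{\mathrm{alg}}(k)$ is the joint distribution of a free family $x_1,\ldots,x_k$ in which every $x_i$ has the centered semicircular distribution of variance $t$; $\mathbb{B}_t(\mu)=\bigl(\mu^{\boxplus(1+t)}\bigr)^{\uplus(1/(1+t))}$; and for $\sigma\in\mathcal{D}_{\mathrm{alg}}(k)$, $\Phi(\sigma)$ is the unique element of $\mathcal{D}_{\mathrm{alg}}(k)$ whose $\eta$-series is $\eta_{\Phi(\sigma)}=\sum_{i=1}^k z_i(1+M_\sigma)z_i$.
   Context: Let $\mathbb{C}\langle X_1,\ldots,X_k\rangle$ be the algebra of non-commutative polynomials, and let $\mathcal{D}_{\mathrm{alg}}(k)$ be the set of linear functionals $\mu:\mathbb{C}\langle X_1,\ldots,X_k\rangle\to\mathbb{C}$ with $\mu(1)=1$. For elements $x_1,\ldots,x_k$ of a non-commutative probability space $(\mathcal{A},\varphi)$ (unital complex algebra with a linear functional, $\varphi(1)=1$), their joint distribution is the $\mu\in\mathcal{D}_{\mathrm{alg}}(k)$ with $\mu(X_{i_1}\cdots X_{i_n})=\varphi(x_{i_1}\cdots x_{i_n})$. Let $\mathbb{C}_0\langle\langle z_1,\ldots,z_k\rangle\rangle$ be the space of formal power series with zero constant term in non-commuting indeterminates $z_1,\ldots,z_k$. For $\mu\in\mathcal{D}_{\mathrm{alg}}(k)$: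 - the moment series is $M_\mu=\sum_{n\ge1}\sum_{i_1,\ldots,i_n=1}^k\mu(X_{i_1}\cdots X_{i_n})z_{i_1}\cdots z_{i_n}$; - the $\eta$-series is $\eta_\mu=M_\mu(1+M_\mu)^{-1}$; - the $R$-transform $R_\mu\in\mathbb{C}_0\langle\langle z_1,\ldots,z_k\rangle\rangle$ is the unique series with $R_\mu\bigl(z_1(1+M_\mu),\ldots,z_k(1+M_\mu)\bigr)=M_\mu$. Both $\mu\mapsto\eta_\mu$ and $\mu\mapsto R_\mu$ are bijections from $\mathcal{D}_{\mathrm{alg}}(k)$ onto $\mathbb{C}_0\langle\langle z_1,\ldots,z_k\rangle\rangle$. For $t>0$, $\mu^{\boxplus t}$ is the unique element of $\mathcal{D}_{\mathrm{alg}}(k)$ with $R_{\mu^{\boxplus t}}=tR_\mu$, and $\mu^{\uplus t}$ is the unique element with $\eta_{\mu^{\uplus t}}=t\eta_\mu$. The free additive convolution $\mu\boxplus\nu$ is the joint distribution of $x_1+y_1,\ldots,x_k+y_k$, where $x_1,\ldots,x_k$ have joint distribution $\mu$, $y_1,\ldots,y_k$ have joint distribution $\nu$, and the two families are freely independent; equivalently $R_{\mu\boxplus\nu}=R_\mu+R_\nu$. *)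

(* Defs.v *)
From HB Require Import structures.
From mathcomp Require Import all_boot all_order all_algebra.
From mathcomp Require Import all_classical all_reals all_analysis.
From mathcomp Require Import complex.
(* The notations of monalg clash with those of MathComp-Analysis. *)
From mathcomp Require Import -(notations) monalg.

Set Implicit Arguments.
Unset Strict Implicit.
Unset Printing Implicit Defensive.

Import Order.TTheory GRing.Theory Num.Theory.

Local Open Scope ring_scope.
Local Open Scope complex_scope.
Local Open Scope classical_set_scope.

(* A series is given by its coefficients, indexed by words in the letters
   [0, ..., k-1]. *)
Record ncseries (K : Type) (k : nat) := NCSeries { nccoef : seq 'I_k -> K }.

Lemma ncseriesP (K : Type) (k : nat) (f g : ncseries K k) :
  (forall w, nccoef f w = nccoef g w) -> f = g.
Proof. by case: f g => [f] [g] /= /funext ->. Qed.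

HB.instance Definition _ (K : Type) (k : nat) := gen_eqMixin (ncseries K k).
HB.instance Definition _ (K : Type) (k : nat) := gen_choiceMixin (ncseries K k).

Section Ring.
Context (K : comNzRingType) (k : nat).
Implicit Types (f g h : ncseries K k) (w : seq 'I_k) (a b : K).

Definition ncs_zero : ncseries K k := NCSeries (fun=> 0).
Definition ncs_opp f := NCSeries (fun w => - nccoef f w).
Definition ncs_add f g := NCSeries (fun w => nccoef f w + nccoef g w).
Definition ncs_scale a f := NCSeries (fun w => a * nccoef f w).
Definition ncs_one : ncseries K k := NCSeries (fun w => (w == [::])%:R).
Definition ncs_mul f g := NCSeries (fun w =>
  \sum_(i < (size w).+1) nccoef f (take i w) * nccoef g (drop i w)).

Fact ncs_addA : associative ncs_add.
Proof. by move=> f g h; apply: ncseriesP => w /=; rewrite addrA. Qed.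
Fact ncs_addC : commutative ncs_add.
Proof. by move=> f g; apply: ncseriesP => w /=; rewrite addrC. Qed.
Fact ncs_add0 : left_id ncs_zero ncs_add.
Proof. by move=> f; apply: ncseriesP => w /=; rewrite add0r. Qed.
Fact ncs_addN : left_inverse ncs_zero ncs_opp ncs_add.
Proof. by move=> f; apply: ncseriesP => w /=; rewrite addNr. Qed.

HB.instance Definition _ := GRing.isZmodule.Build (ncseries K k)
  ncs_addA ncs_addC ncs_add0 ncs_addN.

Fact ncs_mulA : associative ncs_mul.
Proof.
move=> f g h; apply: ncseriesP => w /=.
pose F (i m : nat) := nccoef f (take i w) *
  (nccoef g (take (m - i) (drop i w)) * nccoef h (drop m w)).
transitivity (\sum_(i < (size w).+1) \sum_(m < (size w).+1 | (i <= m)%N) F i m).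
  apply: eq_bigr => i _; rewrite mulr_sumr size_drop.
  have le_i : (i <= size w)%N by rewrite -ltnS.
  rewrite (eq_bigr (fun j : 'I__ => F i (j + i)%N)); last first.
    by move=> j _; rewrite /F addnK drop_drop.
  rewrite -(big_mkord xpredT (fun j => F i (j + i)%N)).
  rewrite -(big_mkord (fun m => (i <= m)%N) (F i)).
  rewrite [RHS](big_cat_nat (n := i)) ?leqW //=.
  have -> : \sum_(0 <= m < i | (i <= m)%N) F i m = 0.
    by rewrite big_nat_cond big1 // => j /andP[/andP[_ /ltn_geF ->]].
  rewrite add0r -[X in _ = \sum_(X <= _ < _ | _) _]add0n big_addn subSn // [RHS]big_mkcond /=.
  by apply: eq_bigr => j _; rewrite leq_addl.
rewrite (exchange_big_dep xpredT) //=; apply: eq_bigr => m _.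
have le_m : (m <= size w)%N by rewrite -ltnS.
rewrite mulr_suml size_take_min (minn_idPl le_m).
rewrite (big_ord_widen_cond (size w).+1 xpredT (fun i =>
  nccoef f (take i (take m w)) * nccoef g (drop i (take m w))
    * nccoef h (drop m w))) //=.
apply: eq_bigr => i le_im.
by rewrite /F mulrA take_takel // take_drop subnK.
Qed.

Fact ncs_mul1 : left_id ncs_one ncs_mul.
Proof.
move=> f; apply: ncseriesP => w /=.
rewrite big_ord_recl take0 drop0 mul1r big1 ?addr0 // => i _.
by case: w i => [[]|x w i] //=; rewrite mul0r.
Qed.

Fact ncs_mulr1 : right_id ncs_one ncs_mul.
Proof.
move=> f; apply: ncseriesP => w /=.
rewrite big_ord_recr /= take_size drop_size mulr1 big1 ?add0r // => i _.
by rewrite -size_eq0 size_drop subn_eq0 leqNgt ltn_ord mulr0.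
Qed.

Fact ncs_mulDl : left_distributive ncs_mul ncs_add.
Proof.
move=> f g h; apply: ncseriesP => w /=.
by rewrite -big_split; apply: eq_bigr => i _ /=; rewrite mulrDl.
Qed.

Fact ncs_mulDr : right_distributive ncs_mul ncs_add.
Proof.
move=> f g h; apply: ncseriesP => w /=.
by rewrite -big_split; apply: eq_bigr => i _ /=; rewrite mulrDr.
Qed.

Fact ncs_one_neq0 : ncs_one != 0 :> ncseries K k.
Proof.
by apply/eqP => /(congr1 (fun f => nccoef f [::]))/eqP /=; rewrite oner_eq0.
Qed.

HB.instance Definition _ := GRing.Zmodule_isNzRing.Build (ncseries K k)
  ncs_mulA ncs_mul1 ncs_mulr1 ncs_mulDl ncs_mulDr ncs_one_neq0.

Fact ncs_scaleA a b f : ncs_scale a (ncs_scale b f) = ncs_scale (a * b) f.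
Proof. by apply: ncseriesP => w /=; rewrite mulrA. Qed.
Fact ncs_scale1 : left_id 1 ncs_scale.
Proof. by move=> f; apply: ncseriesP => w /=; rewrite mul1r. Qed.
Fact ncs_scaleDr : right_distributive ncs_scale +%R.
Proof. by move=> a f g; apply: ncseriesP => w /=; rewrite mulrDr. Qed.
Fact ncs_scaleDl f : {morph ncs_scale^~ f : a b / a + b}.
Proof. by move=> a b; apply: ncseriesP => w /=; rewrite mulrDl. Qed.

HB.instance Definition _ := GRing.Zmodule_isLmodule.Build K (ncseries K k)
  ncs_scaleA ncs_scale1 ncs_scaleDr ncs_scaleDl.

(* The units are by definition the two-sided invertible series; the inverse
   of a non-invertible series is itself, as usual in MathComp. *)
Definition ncs_unit : pred (ncseries K k) :=
  fun f => `[< exists g, g * f = 1 /\ f * g = 1 >].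
Definition ncs_inv f : ncseries K k :=
  if pselect (exists g, g * f = 1 /\ f * g = 1) is left fU
  then projT1 (cid fU) else f.

Fact ncs_mulVr : {in ncs_unit, left_inverse 1 ncs_inv *%R}.
Proof.
move=> f /asboolP fU; rewrite /ncs_inv; case: pselect => // fU'.
by case: cid => g [].
Qed.
Fact ncs_mulrV : {in ncs_unit, right_inverse 1 ncs_inv *%R}.
Proof.
move=> f /asboolP fU; rewrite /ncs_inv; case: pselect => // fU'.
by case: cid => g [].
Qed.
Fact ncs_unitP f g : g * f = 1 /\ f * g = 1 -> ncs_unit f.
Proof. by move=> fg; apply/asboolP; exists g. Qed.
Fact ncs_inv_out : {in [predC ncs_unit], ncs_inv =1 id}.
Proof.
by move=> f /asboolPn fNU; rewrite /ncs_inv; case: pselect.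
Qed.

HB.instance Definition _ := GRing.NzRing_hasMulInverse.Build (ncseries K k)
  ncs_mulVr ncs_mulrV ncs_unitP ncs_inv_out.

Definition ncZ (i : 'I_k) : ncseries K k :=
  NCSeries (fun w => (w == [:: i])%:R).

(* The substitution f(g_1, ..., g_k), meaningful when every g_i has zero
   constant term: words longer than u then do not contribute to the
   coefficient of u, whence the bound on n. *)
Definition ncsubst f (g : 'I_k -> ncseries K k) : ncseries K k :=
  NCSeries (fun u => \sum_(n < (size u).+1) \sum_(w : n.-tuple 'I_k)
    nccoef f w * nccoef (\prod_(i <- w) g i) u).

End Ring.

Arguments ncZ {K k} i.

Definition ncpoly (K : comNzRingType) (k : nat) : Type := malg (fmonom 'I_k) K.

Section Ncpoly.
Context (K : comNzRingType) (k : nat).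

HB.instance Definition _ := GRing.Lalgebra.on (ncpoly K k).

Fact ncpoly_scaleAr (a : K) (p q : ncpoly K k) : a *: (p * q) = p * (a *: q).
Proof.
have comC (r : ncpoly K k) : malgC a * r = r * malgC a.
  rewrite !malgM_def fgmulUg fgmulgU; apply: eq_bigr => m _.
  by rewrite mul1m mulm1 mulrC.
have scaleC (r : ncpoly K k) : a *: r = malgC a * r by rewrite mul_malgC.
by rewrite !scaleC mulrA comC -mulrA.
Qed.

HB.instance Definition _ :=
  GRing.Lalgebra_isAlgebra.Build K (ncpoly K k) ncpoly_scaleAr.

Definition ncX (i : 'I_k) : ncpoly K k := mkmalgU (fmu i) 1.

End Ncpoly.

Arguments ncX {K k} i.

Record Dalg (R : realType) (k : nat) := MkDalg {
  functional :> {scalar ncpoly R[i] k};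
  functional1 : functional 1 = 1 }.

HB.instance Definition _ (R : realType) (k : nat) := gen_eqMixin (Dalg R k).
HB.instance Definition _ (R : realType) (k : nat) := gen_choiceMixin (Dalg R k).

(* Evaluation at 0. Below, [get] stands for "the unique element such that";
   these points are the values it takes when there is no such element. *)
Definition Dalg_point (R : realType) (k : nat) : Dalg R k :=
  @MkDalg R k (mcoeff (@mone (fmonom 'I_k))) (rmorph1 (mcoeff mone)).

HB.instance Definition _ (R : realType) (k : nat) :=
  isPointed.Build (Dalg R k) (Dalg_point R k).
HB.instance Definition _ (R : realType) (k : nat) :=
  isPointed.Build (ncseries R[i] k) 0.

Section Transforms.
Context (R : realType) (k : nat).
Implicit Types (mu nu : Dalg R k) (t : R).

Definition moment_series mu : ncseries R[i] k := NCSeries (fun w =>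
  if w is [::] then 0 else mu (\prod_(i <- w) ncX i)).

Definition eta_series mu : ncseries R[i] k :=
  moment_series mu * (1 + moment_series mu)^-1.

Definition R_transform mu : ncseries R[i] k := get [set f |
  nccoef f [::] = 0 /\
  ncsubst f (fun i => ncZ i * (1 + moment_series mu)) = moment_series mu].

Definition free_power mu t : Dalg R k :=
  get [set rho | R_transform rho = t%:C *: R_transform mu].

Definition boolean_power mu t : Dalg R k :=
  get [set rho | eta_series rho = t%:C *: eta_series mu].

Definition BB t mu : Dalg R k :=
  boolean_power (free_power mu (1 + t)) (1 / (1 + t)).

Definition Phi mu : Dalg R k := get [set rho |
  eta_series rho = \sum_(i < k) ncZ i * (1 + moment_series mu) * ncZ i].

End Transforms.

Record ncprob (R : realType) := NCProb {
  ncp_alg :> algType R[i];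
  ncp_phi : {scalar ncp_alg};
  ncp_phi1 : ncp_phi 1 = 1 }.

Section Freeness.
Context (R : realType).
Implicit Types A : ncprob R.

Definition is_subalgebra A (B : set A) : Prop :=
  [/\ B 1,
      forall (c : R[i]) (a b : A), B a -> B b -> B (c *: a + b)
    & forall a b : A, B a -> B b -> B (a * b)].

Definition gen_subalgebra A (S : set A) : set A := smallest (@is_subalgebra A) S.

(* The unital subalgebras generated by the sets S_i are free: the state
   vanishes on every nonempty product of centered elements a_0 ... a_(n-1) of
   subalgebras of indices i_0, ..., i_(n-1) with consecutive indices distinct. *)
Definition freely_independent A (I : Type) (S : I -> set A) : Prop :=
  forall (n : nat) (i : nat -> I) (a : nat -> A), (0 < n)%N ->
    (forall j, (j < n)%N -> gen_subalgebra (S (i j)) (a j)) ->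
    (forall j, (j < n)%N -> ncp_phi A (a j) = 0) ->
    (forall j, (j.+1 < n)%N -> i j <> i j.+1) ->
    ncp_phi A (\prod_(0 <= j < n) a j) = 0.

Definition has_joint_distribution A (k : nat) (x : 'I_k -> A)
    (mu : Dalg R k) : Prop :=
  forall w : seq 'I_k,
    mu (\prod_(i <- w) ncX i) = ncp_phi A (\prod_(i <- w) x i).

Definition free_convolution (k : nat) (mu nu : Dalg R k) : Dalg R k :=
  get [set rho | exists (A : ncprob R) (x y : 'I_k -> A),
    [/\ has_joint_distribution x mu,
        has_joint_distribution y nu,
        freely_independent (fun b : bool => if b then range x else range y)
      & has_joint_distribution (fun i => x i + y i) rho]].

(* The n-th moment of the centered semicircular law of variance t. *)
Definition semicircle_moment (t : R) (n : nat) : R :=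
  \int[lebesgue_measure]_(u in `[- (2 * Num.sqrt t), 2 * Num.sqrt t])
    (u ^+ n * (Num.sqrt (4 * t - u ^+ 2) / (2 * pi * t))).

Definition semicircular A (t : R) (x : A) : Prop :=
  forall n : nat, ncp_phi A (x ^+ n) = (semicircle_moment t n)%:C.

Definition gamma (k : nat) (t : R) : Dalg R k :=
  get [set rho | exists (A : ncprob R) (x : 'I_k -> A),
    [/\ freely_independent (fun i => [set x i]),
        forall i, semicircular t (x i)
      & has_joint_distribution x rho]].

End Freeness.

(* Main.v *)
(* Let sigma be the convolution of nu with gamma_t and
   S = sum_i z_i (1 + M_sigma) z_i.  Freeness propagates the moment recursion of
   the semicircular law to a Schwinger-Dyson equation: a semicircular letter y
   inside a word Q y P, where Q involves no semicircular letter, contributes t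
   times the sum of phi(U) phi(Q V) over the factorizations P = U y V.  Applied
   to words in the x_i followed by words in the x_i + y_i, this gives
     (1 - t S) (1 + M_sigma) = 1 + M_nu(w_1, ..., w_k),  w_i = z_i (1 - t S)^-1.
   Substituting the w_i in the relation that defines R_mu, mu = Phi(nu), shows
   that the distribution with eta-series (1 + t) S has R-transform
   (1 + t) R_mu, so that B_t(mu) has eta-series S. *)

From HB Require Import structures.
Require Import Defs.
From mathcomp Require Import all_boot all_order all_algebra.
From mathcomp Require Import all_classical all_reals all_analysis.
From mathcomp Require Import complex.
From mathcomp Require Import -(notations) finmap monalg.
From mathcomp Require Import ring lra zify.

Set Implicit Arguments.
Unset Strict Implicit.
Unset Printing Implicit Defensive.

Import Order.TTheory GRing.Theory Num.Theory numFieldNormedType.Exports.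

Local Open Scope ring_scope.

(** * Noncommutative power series *)

(** [Phi], [gamma], [free_convolution] and the convolution powers are defined by [get], so each
    needs a witness before anything can be said of it. For [gamma] and [free_convolution] this means
    building free families with prescribed marginals. Freeness is therefore moved to words: on a
    word with several monochromatic blocks, the vanishing on products of centered blocks expresses
    the functional through shorter words, which is a recursive definition. The same products,
    preceded by one uncentered block, span all polynomials, so the Schwinger-Dyson equation has only
    to be checked on them. The mixed words of the overview are stable under expansion of their first
    sum: x_j joins the prefix, and y_j is removed by the Schwinger-Dyson equation. The resulting
    identity of series follows by comparing two families that solve the same system X = c + sum_j
    s_j X_j, where the s_j have no constant term. *)

Lemma contraction_fixpoint (L V : Type) (T : (seq L -> V) -> seq L -> V)
    (f0 : seq L -> V) :
  (forall f g w, (forall v, (size v < size w)%N -> f v = g v) ->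
     T f w = T g w) ->
  exists f, forall w, f w = T f w.
Proof.
(* The iterates stabilize: their value at [w] no longer changes after [size w + 1] rounds. *)
move=> cT; pose F n := iter n T f0.
have stab n m w : (size w < n)%N -> (n <= m)%N -> F n w = F m w.
  elim: n m w => [|n IHn] [|m] w //; rewrite !ltnS => wn nm.
  by apply: cT => v vw; apply: IHn => //; apply: leq_trans vw wn.
exists (fun w => F (size w).+1 w) => w.
by apply: cT => v vw; apply/esym/stab.
Qed.

Section Series.
Context (K : comNzRingType) (k : nat).
Implicit Types (f g h : ncseries K k) (w u : seq 'I_k).

Lemma nccoef_sum (I : Type) (r : seq I) (P : pred I) (F : I -> ncseries K k) w :
  nccoef (\sum_(i <- r | P i) F i) w = \sum_(i <- r | P i) nccoef (F i) w.
Proof. by elim/big_rec2: _ => //= i a b _ <-. Qed.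

Lemma nccoefM0 f g : nccoef (f * g) [::] = nccoef f [::] * nccoef g [::].
Proof. by rewrite /= big_ord1. Qed.

Definition ncs_eqn n f g := forall w, (size w < n)%N -> nccoef f w = nccoef g w.

Lemma ncs_eqnP f g : (forall n, ncs_eqn n f g) -> f = g.
Proof. by move=> fg; apply: ncseriesP => w; apply: (fg (size w).+1). Qed.

Lemma ncs_eqn_mul n f f' g g' :
  ncs_eqn n f f' -> ncs_eqn n g g' -> ncs_eqn n (f * g) (f' * g').
Proof.
move=> ff' gg' w wn /=; apply: eq_bigr => i _; rewrite ff' ?gg' //.
  by rewrite size_drop (leq_ltn_trans (leq_subr _ _)).
by rewrite size_take_min (leq_ltn_trans (geq_minr _ _)).
Qed.

(** The contraction estimates rest on this gain of one degree: when [f] has no constant term, the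
    second factor is read only on proper suffixes. *)
Lemma ncs_eqn_mull n f g g' : nccoef f [::] = 0 ->
  ncs_eqn n g g' -> ncs_eqn n.+1 (f * g) (f * g').
Proof.
move=> f0 gg' w wn /=; apply: eq_bigr => -[[|i] /= iw] _.
  by rewrite take0 f0 !mul0r.
rewrite gg' // size_drop; case: w wn iw => //= x w wn _.
by rewrite subSS (leq_ltn_trans (leq_subr _ _)).
Qed.

Lemma ncs_eqn_sum n (I : Type) (r : seq I) (F G : I -> ncseries K k) :
  (forall i, ncs_eqn n (F i) (G i)) ->
  ncs_eqn n (\sum_(i <- r) F i) (\sum_(i <- r) G i).
Proof.
by move=> FG w wn; rewrite !nccoef_sum; apply: eq_bigr => i _; exact: FG.
Qed.

Lemma ncs_rinv f : nccoef f [::] = 0 -> exists g, (1 - f) * g = 1.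
Proof.
move=> f0; have [|g' gE] := @contraction_fixpoint 'I_k K
  (fun a w => nccoef (1 + f * NCSeries a) w) (fun=> 0); last first.
  exists (NCSeries g'); apply/eqP; rewrite mulrBl mul1r subr_eq; apply/eqP.
  by apply: ncseriesP => w; rewrite {1}/nccoef gE.
move=> g h w gh; congr (_ + _).
by apply: (ncs_eqn_mull (n := size w) f0).
Qed.

(** The right inverse from [ncs_rinv] has constant term 1 in its turn, hence a right inverse of its
    own, and associativity identifies the latter with 1 - f. *)
Lemma ncs_unitrB f : nccoef f [::] = 0 -> 1 - f \is a GRing.unit.
Proof.
move=> f0; have [g fg] := ncs_rinv f0.
have g0 : nccoef (1 - g) [::] = 0.
  have := congr1 (fun x => nccoef x [::]) fg.
  by rewrite nccoefM0 /= f0 subr0 mul1r => ->; rewrite subrr.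
have [g'] := ncs_rinv g0; rewrite subKr => gg'.
have := mulrA (1 - f) g g'; rewrite fg gg' mulr1 mul1r => fE.
by apply/unitrP; exists g; rewrite fg fE gg'.
Qed.

Lemma ncs_unitrD f : nccoef f [::] = 0 -> 1 + f \is a GRing.unit.
Proof. by move=> f0; rewrite -[f]opprK ncs_unitrB //= f0 oppr0. Qed.

Lemma ncs_scaleAl (a : K) f g : a *: f * g = a *: (f * g).
Proof.
apply: ncseriesP => w /=; rewrite mulr_sumr; apply: eq_bigr => i _.
by rewrite mulrA.
Qed.

Lemma ncs_scaleAr (a : K) f g : f * (a *: g) = a *: (f * g).
Proof.
apply: ncseriesP => w /=; rewrite mulr_sumr; apply: eq_bigr => i _.
by rewrite mulrCA.
Qed.

(** The left quotient by a letter. It makes a series behave like a state of an automaton, with its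
    constant term as output. *)
Definition lderiv (j : 'I_k) f : ncseries K k :=
  NCSeries (fun w => nccoef f (j :: w)).

Lemma nccoefZl (j : 'I_k) f w : nccoef (ncZ j * f) w =
  if w is i :: v then (i == j)%:R * nccoef f v else 0.
Proof.
case: w => [|i v] /=; first by rewrite big_ord1 /= mul0r.
rewrite big_ord_recl mul0r add0r big_ord_recl /= take0 drop0 big1 ?addr0.
  by rewrite eqseq_cons andbT.
move=> [l lv] _; rewrite /bump /= !add1n /= eqseq_cons andbC.
by case: v lv => [|? ?] //= _; rewrite mul0r.
Qed.

Lemma lderiv_sumZ (c : K) (F : 'I_k -> ncseries K k) j :
  lderiv j (c *: (1 : ncseries K k) + \sum_i ncZ i * F i) = F j.
Proof.
apply: ncseriesP => w; rewrite [LHS]/= mulr0 add0r nccoef_sum.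
rewrite (bigD1 j) // nccoefZl eqxx mul1r big1 => [|i /andP[_ ij]].
  by rewrite [LHS]addr0.
by rewrite nccoefZl eq_sym (negbTE ij) mul0r.
Qed.

Lemma ncs_lderivE f :
  f = nccoef f [::] *: (1 : ncseries K k) + \sum_j ncZ j * lderiv j f.
Proof.
apply: ncseriesP => -[|i w].
  rewrite /= nccoef_sum big1 ?addr0 ?mulr1 // => j _.
  by rewrite nccoefZl.
by rewrite -[RHS]/(nccoef (lderiv i _) w) lderiv_sumZ.
Qed.

Lemma lderivM j f g :
  lderiv j (f * g) = lderiv j f * g + nccoef f [::] *: lderiv j g.
Proof.
apply: ncseriesP => w; rewrite /= big_ord_recl /= addrC.
by congr (_ + _); apply: eq_bigr => i _.
Qed.

Section Substitution.
Context (s : 'I_k -> ncseries K k) (s0 : forall i, nccoef (s i) [::] = 0).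

Lemma nccoef_prod_small u w : (size u < size w)%N ->
  nccoef (\prod_(i <- w) s i) u = 0.
Proof.
elim: w u => [|j w IHw] u //= uw; rewrite big_cons /=.
apply: big1 => -[[|i] /= iu] _; first by rewrite take0 s0 mul0r.
rewrite IHw ?mulr0 // size_drop; case: u uw iu => //= x u uw _.
by rewrite subSS (leq_ltn_trans (leq_subr _ _)).
Qed.

Lemma nccoef_subst n f u : (size u < n)%N -> nccoef (ncsubst f s) u =
  \sum_(m < n) \sum_(v : m.-tuple 'I_k)
    nccoef f v * nccoef (\prod_(i <- v) s i) u.
Proof.
move=> un; rewrite /= (big_ord_widen n (fun m => \sum_(v : m.-tuple 'I_k)
    nccoef f v * nccoef (\prod_(i <- v) s i) u)) // big_mkcond /=.
apply: eq_bigr => m _; case: ltnP => // um.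
by rewrite big1 // => v _; rewrite nccoef_prod_small ?size_tuple // mulr0.
Qed.

Lemma sum_tupleS (V : nmodType) n (F : seq 'I_k -> V) :
  \sum_(v : n.+1.-tuple 'I_k) F v =
  \sum_j \sum_(v : n.-tuple 'I_k) F (j :: v).
Proof.
rewrite pair_bigA /=.
rewrite (reindex (fun p : 'I_k * n.-tuple 'I_k => [tuple of p.1 :: p.2])) //=.
exists (fun v => (thead v, [tuple of behead v])) => [[j v]|v] _ /=.
  by rewrite theadE; congr (_, _); apply: val_inj.
by rewrite -tuple_eta.
Qed.

Lemma ncsubstE f :
  ncsubst f s =
  nccoef f [::] *: (1 : ncseries K k) + \sum_j s j * ncsubst (lderiv j f) s.
Proof.
apply: ncseriesP => u.
(* The bound is one more than in the definition of [ncsubst]: splitting off the first letter takes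
   one length away, and the tails must still reach length [size u]. *)
rewrite (@nccoef_subst (size u).+2) // big_ord_recl /=; congr (_ + _).
  rewrite (big_pred1 [tuple]) => [|w]; first by rewrite big_nil.
  by rewrite [w]tuple0 /= eqxx.
rewrite nccoef_sum.
under eq_bigr => m _ do rewrite (sum_tupleS _ (fun w =>
  nccoef f w * nccoef (\prod_(i <- w) s i) u)).
rewrite exchange_big /=; apply: eq_bigr => j _ /=.
transitivity (\sum_(l < (size u).+1) nccoef (s j) (take l u) *
    \sum_(m < (size u).+1) \sum_(v : m.-tuple 'I_k)
      nccoef (lderiv j f) v * nccoef (\prod_(i <- v) s i) (drop l u));
  last first.
  apply: eq_bigr => l _; congr (_ * _).
  by rewrite -nccoef_subst // size_drop ltnS leq_subr.
under [RHS]eq_bigr do rewrite mulr_sumr.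
rewrite exchange_big /=; apply: eq_bigr => m _.
under [RHS]eq_bigr do rewrite mulr_sumr.
rewrite exchange_big /=; apply: eq_bigr => v _.
rewrite big_cons /= mulr_sumr.
by apply: eq_bigr => l _; rewrite mulrCA.
Qed.

(** The system is guarded by the [s j]: as these have no constant term, each degree of a member is
    determined by lower degrees of the others. *)
Lemma lderiv_unique (T : Type) (out : T -> K) (step : T -> 'I_k -> T)
    (X Y : T -> ncseries K k) :
  (forall x, X x = out x *: (1 : ncseries K k) + \sum_j s j * X (step x j)) ->
  (forall x, Y x = out x *: (1 : ncseries K k) + \sum_j s j * Y (step x j)) ->
  forall x, X x = Y x.
Proof.
move=> XE YE x; apply: ncs_eqnP => n; elim: n x => [//|n IHn] x w wn.
rewrite XE YE; congr (_ + _); move: w wn; apply: ncs_eqn_sum => j.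
by apply: ncs_eqn_mull.
Qed.

Lemma ncsubstD f g : ncsubst (f + g) s = ncsubst f s + ncsubst g s.
Proof.
apply: ncseriesP => u /=; rewrite -big_split; apply: eq_bigr => m _ /=.
by rewrite -big_split; apply: eq_bigr => w _ /=; rewrite mulrDl.
Qed.

Lemma ncsubstZ (a : K) f : ncsubst (a *: f) s = a *: ncsubst f s.
Proof.
apply: ncseriesP => u /=; rewrite mulr_sumr; apply: eq_bigr => m _ /=.
by rewrite mulr_sumr; apply: eq_bigr => w _ /=; rewrite mulrA.
Qed.

Lemma ncsubst0 : ncsubst 0 s = 0.
Proof. by rewrite -[X in ncsubst X](scale0r 0) ncsubstZ scale0r. Qed.

Lemma ncsubst_sum (I : Type) (r : seq I) (F : I -> ncseries K k) :
  ncsubst (\sum_(i <- r) F i) s = \sum_(i <- r) ncsubst (F i) s.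
Proof. by elim/big_rec2: _ => [|i a b _ <-]; rewrite ?ncsubst0 ?ncsubstD. Qed.

Lemma ncsubst1 : ncsubst 1 s = 1.
Proof.
rewrite ncsubstE scale1r big1 ?addr0 // => j _.
by rewrite (_ : lderiv j 1 = 0) ?ncsubst0 ?mulr0 //; apply: ncseriesP.
Qed.

Lemma ncsubst_ncZ i : ncsubst (ncZ i) s = s i.
Proof.
rewrite ncsubstE scale0r add0r (bigD1 i) //= big1 => [|j ji].
  rewrite (_ : lderiv i _ = 1) ?ncsubst1 ?mulr1 ?addr0 //.
  by apply: ncseriesP => w /=; rewrite eqseq_cons eqxx.
rewrite (_ : lderiv j _ = 0) ?ncsubst0 ?mulr0 //.
by apply: ncseriesP => w /=; rewrite eqseq_cons (negbTE ji).
Qed.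

Lemma nccoef_subst0 f : nccoef (ncsubst f s) [::] = nccoef f [::].
Proof.
rewrite ncsubstE /= nccoef_sum big1 ?addr0 ?mulr1 // => j _.
by rewrite nccoefM0 s0 mul0r.
Qed.

Lemma ncsubstM f g : ncsubst (f * g) s = ncsubst f s * ncsubst g s.
Proof.
apply/eqP; rewrite -subr_eq0; apply/eqP; move: f.
pose X f := ncsubst (f * g) s - ncsubst f s * ncsubst g s.
apply: (@lderiv_unique _ (fun=> 0) (fun f j => lderiv j f) X (fun=> 0)) => f.
  have -> : X f = \sum_j s j * ncsubst (lderiv j f * g) s
      + nccoef f [::] *: ncsubst g s
      - (\sum_j s j * ncsubst (lderiv j f) s * ncsubst g s
         + nccoef f [::] *: ncsubst g s).
    congr (_ - _); last first.
      rewrite {1}[ncsubst f s]ncsubstE mulrDl ncs_scaleAl mul1r addrC.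
      by rewrite mulr_suml.
    rewrite {1}ncsubstE nccoefM0 [ncsubst g s]ncsubstE scalerDr scalerA.
    rewrite addrCA; congr (_ + _); rewrite scaler_sumr -big_split.
    apply: eq_bigr => j _ /=.
    by rewrite lderivM ncsubstD mulrDr ncsubstZ ncs_scaleAr.
  rewrite opprD addrACA subrr addr0 -sumrB scale0r add0r.
  by apply: eq_bigr => j _; rewrite mulrBr mulrA.
by rewrite scale0r add0r big1 // => j _; rewrite mulr0.
Qed.

Lemma ncsubstV f : f \is a GRing.unit -> ncsubst f^-1 s = (ncsubst f s)^-1.
Proof.
move=> fU; have sfU : ncsubst f s \is a GRing.unit.
  apply/unitrP; exists (ncsubst f^-1 s).
  by rewrite -!ncsubstM mulVr ?mulrV ?ncsubst1.
by apply: (mulrI sfU); rewrite -ncsubstM !mulrV // ncsubst1.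
Qed.

End Substitution.

Lemma ncsubst_comp (s r : 'I_k -> ncseries K k) f :
  (forall i, nccoef (s i) [::] = 0) -> (forall i, nccoef (r i) [::] = 0) ->
  ncsubst (ncsubst f r) s = ncsubst f (fun i => ncsubst (r i) s).
Proof.
move=> s0 r0.
have rs0 i : nccoef (ncsubst (r i) s) [::] = 0 by rewrite nccoef_subst0.
move: f; apply: (@lderiv_unique _ rs0 _ (fun f => nccoef f [::])
  (fun f j => lderiv j f)) => f; last exact: ncsubstE.
rewrite [ncsubst f r]ncsubstE // ncsubstD ncsubstZ ncsubst1 // ncsubst_sum.
by under eq_bigr do rewrite ncsubstM //.
Qed.

Lemma ncs_eqn_subst n (s r : 'I_k -> ncseries K k) f :
  (forall i, nccoef (s i) [::] = 0) -> (forall i, nccoef (r i) [::] = 0) ->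
  (forall i, ncs_eqn n (s i) (r i)) -> ncs_eqn n (ncsubst f s) (ncsubst f r).
Proof.
move=> s0 r0 sr; suff H m : (m <= n)%N -> ncs_eqn m (ncsubst f s) (ncsubst f r).
  exact: H.
elim: m f => [//|m IHm] f mn; rewrite !ncsubstE // => w wm.
congr (_ + _); move: w wm; apply: ncs_eqn_sum => j w wm.
rewrite (ncs_eqn_mull (s0 j) (IHm (lderiv j f) (ltnW mn))) //.
apply: (ncs_eqn_mul (n := m.+1)) => // v vm.
by rewrite sr // (leq_trans vm).
Qed.

Section Twisted.
(* The R-transform of a series [m] is obtained by inverting the substitution of
   z_i (1 + m) for z_i. *)
Implicit Types m : ncseries K k.

Definition ncZ_twist m (i : 'I_k) : ncseries K k := ncZ i * (1 + m).

Lemma nccoef_ncZ_twist0 m i : nccoef (ncZ_twist m i) [::] = 0.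
Proof. by rewrite nccoefM0 mul0r. Qed.

Lemma lderiv_subst_twist m f j :
  lderiv j (ncsubst f (ncZ_twist m)) =
  (1 + m) * ncsubst (lderiv j f) (ncZ_twist m).
Proof.
rewrite ncsubstE; last exact: nccoef_ncZ_twist0.
under eq_bigr do rewrite -mulrA.
exact: lderiv_sumZ.
Qed.

(** By [lderiv_subst_twist], the quotient by z_j of a substituted series is 1 + m times the
    substituted quotient. Dividing by 1 + m after each letter therefore recovers the quotients of
    [f], and the constant term reached at the end of a word is its coefficient. *)
Lemma ncsubst_twist_surj m h : nccoef m [::] = 0 ->
  exists f, ncsubst f (ncZ_twist m) = h.
Proof.
move=> m0; have mU := ncs_unitrD m0.
pose step g j := (1 + m)^-1 * lderiv j g.
exists (NCSeries (fun w => nccoef (foldl step h w) [::])); move: h.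
apply: (@lderiv_unique _ (nccoef_ncZ_twist0 m) _ (fun f => nccoef f [::]) step)
  => h.
  exact/ncsubstE/nccoef_ncZ_twist0.
rewrite {1}[h]ncs_lderivE; congr (_ + _).
by apply: eq_bigr => j _; rewrite /step /ncZ_twist -mulrA mulVKr.
Qed.

Lemma ncsubst_twist_inj m f g : nccoef m [::] = 0 ->
  ncsubst f (ncZ_twist m) = ncsubst g (ncZ_twist m) -> f = g.
Proof.
move=> m0 fg; apply: ncseriesP => w; have mU := ncs_unitrD m0.
elim: w f g fg => [|j w IHw] f g fg.
  have := congr1 (fun x => nccoef x [::]) fg.
  by rewrite !nccoef_subst0 //; exact: nccoef_ncZ_twist0.
apply: (IHw (lderiv j f) (lderiv j g)); apply: (mulrI mU).
by rewrite -!lderiv_subst_twist fg.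
Qed.

(** The twist puts z_i in front of 1 + m, so agreement of [m] and [m'] below some degree propagates
    one degree higher. This makes the R-transform injective. *)
Lemma ncsubst_twist_fixpoint_unique f m m' :
  ncsubst f (ncZ_twist m) = m -> ncsubst f (ncZ_twist m') = m' -> m = m'.
Proof.
move=> mE m'E; apply: ncs_eqnP; elim=> [//|n IHn].
rewrite -mE -m'E; apply: ncs_eqn_subst => i; try exact: nccoef_ncZ_twist0.
by apply: ncs_eqn_mull => // w wn /=; rewrite IHn.
Qed.

End Twisted.

Section Subordination.

Definition sandwich f : ncseries K k := \sum_(i < k) ncZ i * f * ncZ i.

Lemma sandwich0 f : nccoef (sandwich f) [::] = 0.
Proof. by rewrite nccoef_sum big1 // => i _; rewrite nccoefM0 mulr0. Qed.

(* With S = sandwich G and a = 1 - t S, the first hypothesis says that the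
   substitution z_i |-> z_i a^-1 maps H to a G.  It then maps
   1 + m = (1 - sandwich H)^-1 to a (1 - (1 + t) S)^-1 = a (1 + r), hence the
   twist of m to the twist of r. *)
Lemma subordination_R_transform (t : K) (G H m r f : ncseries K k) :
  (1 - t *: sandwich G) * G =
    ncsubst H (fun i => ncZ i * (1 - t *: sandwich G)^-1) ->
  1 + r = (1 - (1 + t) *: sandwich G)^-1 ->
  1 + m = (1 - sandwich H)^-1 ->
  ncsubst f (ncZ_twist m) = m ->
  ncsubst ((1 + t) *: f) (ncZ_twist r) = r.
Proof.
set S := sandwich G; set a := 1 - t *: S; set w := fun i => _.
set b := 1 - (1 + t) *: S => subord rE mE fE.
have S0 : nccoef S [::] = 0 by exact: sandwich0.
have aU : a \is a GRing.unit by apply: ncs_unitrB; rewrite /= S0 mulr0.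
have bU : b \is a GRing.unit by apply: ncs_unitrB; rewrite /= S0 mulr0.
(* The computation turns on this relation: 1 - S a^-1, the image of 1 - sandwich H, equals b a^-1,
   and 1 + S b^-1 equals a b^-1. *)
have abS : a - b = S.
  by rewrite /a /b opprB addrC addrA subrK -scalerBl addrK scale1r.
have w0 i : nccoef (w i) [::] = 0 by rewrite nccoefM0 mul0r.
have Hw : ncsubst (sandwich H) w = S * a^-1.
  rewrite ncsubst_sum mulr_suml; apply: eq_bigr => i _.
  rewrite !(ncsubstM w0) !(ncsubst_ncZ w0) -subord /w !mulrA.
  by rewrite (mulrVK aU).
have mw : ncsubst (1 + m) w = a * b^-1.
  rewrite mE (ncsubstV w0 (ncs_unitrB (sandwich0 H))).
  rewrite -scaleN1r ncsubstD ncsubstZ (ncsubst1 w0) scaleN1r Hw.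
  rewrite -{1}(mulrV aU) -mulrBl -{1}abS subKr.
  by rewrite invrM ?unitrV // invrK.
have mwE : ncsubst m w = S * b^-1.
  apply: (addrI 1); rewrite -{1}(ncsubst1 w0) -ncsubstD mw.
  by rewrite -{1}(mulrV bU) -mulrDl -abS addrC subrK.
have twist_w : ncZ_twist r = fun i => ncsubst (ncZ_twist m i) w.
  apply/funext => i; rewrite (ncsubstM w0) (ncsubst_ncZ w0) mw.
  by rewrite /w -mulrA (mulKr aU) /ncZ_twist rE.
rewrite ncsubstZ twist_w -(ncsubst_comp _ w0 (nccoef_ncZ_twist0 m)) fE mwE.
apply: (addrI 1); rewrite rE -ncs_scaleAl -{1}(mulrV bU) -mulrDl.
by rewrite /b subrK mul1r.
Qed.

End Subordination.

End Series.

(** * Distributions and their transforms *)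

Lemma ncword_mkmalgU (K : comNzRingType) (k : nat) (w : seq 'I_k) :
  \prod_(i <- w) ncX i = mkmalgU (FMonom w) 1 :> ncpoly K k.
Proof.
elim: w => [|i w IHw].
  by rewrite big_nil; congr mkmalgU; apply/eqP; rewrite fmP fm1.
rewrite big_cons IHw /ncX malgM_def fgmulUU mulr1; congr mkmalgU.
by apply/eqP; rewrite fmP fmM fmU.
Qed.

Lemma ncpoly_word_span (K : comNzRingType) (k : nat) (p : ncpoly K k) :
  exists r : seq (K * seq 'I_k),
    p = \sum_(x <- r) x.1 *: \prod_(i <- x.2) ncX i.
Proof.
exists [seq (mcoeff u p, fmonom_val u) | u <- enum_fset (msupp p)].
rewrite big_map {1}[p]monalgE; apply: eq_bigr => u _ /=.
rewrite ncword_mkmalgU fmK; apply/malgP => v.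
by rewrite mcoeffZ [LHS]mcoeffU [X in _ * X]mcoeffU mulrnAr mulr1.
Qed.

Lemma scalar_ncpoly_ext (K : comNzRingType) (k : nat)
    (f g : {scalar ncpoly K k}) :
  (forall w, f (\prod_(i <- w) ncX i) = g (\prod_(i <- w) ncX i)) -> f =1 g.
Proof.
move=> fg p; have [r ->] := ncpoly_word_span p; rewrite !linear_sum.
by apply: eq_bigr => x _; rewrite !linearZ fg.
Qed.

Lemma scalar_ncpoly_exists (K : comNzRingType) (k : nat) (m : seq 'I_k -> K) :
  exists f : {scalar ncpoly K k}, forall w, f (\prod_(i <- w) ncX i) = m w.
Proof.
pose f (p : ncpoly K k) : K := mmap idfun (fun u : fmonom 'I_k => m u) p.
have flin : scalar f.
  move=> a p q; rewrite /f mmapD; congr (_ + _).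
  rewrite (mmapEw (msuppZ_le _ _)) /mmap mulr_sumr.
  by apply: eq_bigr => u _; rewrite mcoeffZ /= mulrA.
pose F : {scalar ncpoly K k} := HB.pack f (GRing.isLinear.Build _ _ _ _ f flin).
by exists F => w; rewrite ncword_mkmalgU /= /f mmapU mul1r.
Qed.

Section Dalg.
Context (R : realType) (k : nat).
Implicit Types (mu nu rho : Dalg R k) (m : ncseries R[i] k).

Lemma Dalg_ext mu nu :
  (forall w, mu (\prod_(i <- w) ncX i) = nu (\prod_(i <- w) ncX i)) -> mu = nu.
Proof.
case: mu nu => [f f1] [g g1] /= /scalar_ncpoly_ext/funext fg.
have fgE : f = g.
  case: f g fg {f1 g1} => [f [[f1] [f2]]] [g [[g1] [g2]]] /= fg.
  subst g; congr GRing.Linear.Pack; congr GRing.Linear.Class.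
  - by f_equal; apply: Prop_irrelevance.
  - by f_equal; apply: Prop_irrelevance.
by subst g; congr MkDalg; apply: Prop_irrelevance.
Qed.

Lemma Dalg_exists (a : seq 'I_k -> R[i]) : a [::] = 1 ->
  exists mu : Dalg R k, forall w, mu (\prod_(i <- w) ncX i) = a w.
Proof.
move=> a1; have [f fE] := scalar_ncpoly_exists a.
have f1 : f 1 = 1 by rewrite -a1 -fE big_nil.
by exists (MkDalg f1).
Qed.

Lemma nccoef_moment mu w :
  nccoef (1 + moment_series mu) w = mu (\prod_(i <- w) ncX i).
Proof.
case: w => [|i w]; rewrite /= ?add0r //.
by rewrite addr0 big_nil functional1.
Qed.

Lemma moment_series_inj : injective (@moment_series R k).
Proof.
by move=> mu nu munu; apply: Dalg_ext => w; rewrite -!nccoef_moment munu.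
Qed.

Lemma moment_series_surj m : nccoef m [::] = 0 ->
  exists mu, moment_series mu = m.
Proof.
move=> m0; have [|mu muE] := @Dalg_exists (nccoef (1 + m)).
  by rewrite /= m0 addr0.
exists mu; apply: (addrI 1); apply: ncseriesP => w.
by rewrite nccoef_moment muE.
Qed.

Lemma moment_unit mu : 1 + moment_series mu \is a GRing.unit.
Proof. exact: ncs_unitrD. Qed.

Lemma eta_seriesE mu : 1 - eta_series mu = (1 + moment_series mu)^-1.
Proof.
apply: (mulIr (moment_unit mu)).
by rewrite mulrBl mul1r mulVr ?moment_unit // mulrVK ?moment_unit // addrK.
Qed.

Lemma moment_eta mu : 1 + moment_series mu = (1 - eta_series mu)^-1.
Proof. by rewrite eta_seriesE invrK. Qed.

Lemma eta_series_inj : injective (@eta_series R k).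
Proof.
move=> mu nu munu; apply/moment_series_inj/(addrI 1).
by rewrite !moment_eta munu.
Qed.

Lemma eta_series_surj m : nccoef m [::] = 0 -> exists mu, eta_series mu = m.
Proof.
move=> m0; have mU := ncs_unitrB m0.
have [|mu muE] := @moment_series_surj ((1 - m)^-1 - 1).
  have /(congr1 (fun f => nccoef f [::])) := mulVr mU.
  by rewrite nccoefM0 /= m0 subr0 mulr1 => ->; rewrite subrr.
exists mu; have := eta_seriesE mu.
by rewrite muE subrKC invrK => /addrI/oppr_inj.
Qed.

Lemma R_transform_unique mu m : nccoef m [::] = 0 ->
  ncsubst m (ncZ_twist (moment_series mu)) = moment_series mu ->
  R_transform mu = m.
Proof.
move=> m0 mE; apply: get_unique => // m' [_ m'E].
by apply: (@ncsubst_twist_inj _ _ (moment_series mu)) => //; rewrite mE.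
Qed.

Lemma R_transformE mu :
  ncsubst (R_transform mu) (ncZ_twist (moment_series mu)) = moment_series mu.
Proof.
have [//|m mE] := @ncsubst_twist_surj _ _ (moment_series mu) (moment_series mu).
suff m0 : nccoef m [::] = 0 by rewrite (R_transform_unique m0).
by rewrite -(nccoef_subst0 (nccoef_ncZ_twist0 (moment_series mu))) mE.
Qed.

Lemma R_transform0 mu : nccoef (R_transform mu) [::] = 0.
Proof.
rewrite -(nccoef_subst0 (nccoef_ncZ_twist0 (moment_series mu))).
by rewrite R_transformE.
Qed.

Lemma R_transform_inj : injective (@R_transform R k).
Proof.
move=> mu nu munu; apply/moment_series_inj.
apply: (@ncsubst_twist_fixpoint_unique _ _ (R_transform mu)).
  exact: R_transformE.
by rewrite munu R_transformE.
Qed.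

Lemma eta_Phi mu : eta_series (Phi mu) = sandwich (1 + moment_series mu).
Proof.
have [rho rhoE] := eta_series_surj (sandwich0 (1 + moment_series mu)).
suff -> : Phi mu = rho by [].
by apply: get_unique => // y yE; apply: eta_series_inj; rewrite rhoE.
Qed.

Lemma BB_Phi_subordination (nu sigma : Dalg R k) (t : R) : 0 < t ->
  let S := sandwich (1 + moment_series sigma) in
  (1 - t%:C%C *: S) * (1 + moment_series sigma) =
    ncsubst (1 + moment_series nu) (fun i => ncZ i * (1 - t%:C%C *: S)^-1) ->
  BB t (Phi nu) = Phi sigma.
Proof.
move=> t0 S subord.
have s0 : 1 + t != 0 by rewrite gt_eqF // addr_gt0.
have sC : (1 + t)%:C%C = 1 + t%:C%C :> R[i] by rewrite rmorphD rmorph1.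
have [rho rhoE] : exists rho, eta_series rho = (1 + t%:C%C) *: S.
  by apply: eta_series_surj; rewrite /= sandwich0 mulr0.
have Rrho : R_transform rho = (1 + t)%:C%C *: R_transform (Phi nu).
  apply: R_transform_unique; first by rewrite /= R_transform0 mulr0.
  rewrite sC.
  apply: (subordination_R_transform (m := moment_series (Phi nu)) subord).
  - by rewrite moment_eta rhoE.
  - by rewrite moment_eta eta_Phi.
  - exact: R_transformE.
have powE : free_power (Phi nu) (1 + t) = rho.
  apply: get_unique; first exact: Rrho.
  by move=> y yE; apply: R_transform_inj; rewrite yE Rrho.
have sV : (1 / (1 + t))%:C%C * (1 + t%:C%C) = 1 :> R[i].
  by rewrite -sC -rmorphM /= mul1r mulVf.
rewrite /BB powE; apply: get_unique.
  suff : eta_series (Phi sigma) = (1 / (1 + t))%:C%C *: eta_series rho by [].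
  by rewrite eta_Phi rhoE scalerA sV scale1r.
move=> y yE; apply: eta_series_inj.
by rewrite yE rhoE scalerA sV scale1r eta_Phi.
Qed.

End Dalg.

(** * Freeness on words *)

Section Words.
Context (K : comNzRingType) (L I : eqType) (c : L -> I).
Implicit Types (f g p q : seq L -> K) (i : I) (u v w : seq L)
  (us vs : seq (seq L)).

Definition monochrome i u := all (fun l => c l == i) u.

Definition colour u : option I := ohead (map c u).

Definition block u := if u is l :: u' then monochrome (c l) u' else false.

(** [x] is the colour standing before the list; [None] imposes nothing, since a block always has a
    colour. *)
Definition alternates (x : option I) us :=
  all block us && path (fun a b => a != b) x (map colour us).

Lemma blockP u : reflect
  (exists2 i, monochrome i u & colour u = Some i) (block u).
Proof.
case: u => [|l u] /=; first by constructor; case.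
apply: (iffP idP) => [lu|[i /= /andP[_ iu] [->]] //].
by exists (c l) => //=; rewrite eqxx.
Qed.

Lemma monochrome_block i u : monochrome i u -> u != [::] ->
  block u /\ colour u = Some i.
Proof.
by case: u => //= l u /andP[/eqP <- iu] _.
Qed.

Lemma alternates_None (x : option I) us : alternates x us -> alternates None us.
Proof.
rewrite /alternates; case: us => //= u us /andP[/andP[bu ->] /andP[_ ->]].
by rewrite !andbT bu; case/blockP: bu => ? _ ->.
Qed.

Lemma alternates_cons x u us :
  alternates x (u :: us) =
  [&& block u, x != colour u & alternates (colour u) us].
Proof. by rewrite /alternates /= -andbA; congr (_ && _); rewrite andbCA. Qed.

Fixpoint blocks w : seq (seq L) :=
  if w is l :: w' then
    match blocks w' with
    | (l' :: u) :: us => if c l == c l' then (l :: l' :: u) :: us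
                         else [:: l] :: (l' :: u) :: us
    | _ => [:: [:: l]]
    end
  else [::].

Lemma alternates_blocks w :
  flatten (blocks w) = w /\ alternates None (blocks w).
Proof.
elim: w => [//|l w [fw aw]] /=.
case: (blocks w) fw aw => [|[|l' u] us] /= <- aw //.
case: ifP => /= ll'; split=> //; move: aw; rewrite !alternates_cons /=.
  by rewrite /colour /= (eqP ll') eqxx.
rewrite /colour /= => /andP[-> ->]; rewrite !andbT.
by apply: contraFN ll' => /eqP[->].
Qed.

Lemma blocks_flatten us : alternates None us -> blocks (flatten us) = us.
Proof.
elim: us => [//|u us IHus]; rewrite alternates_cons => /and3P[bu _ aus].
have {}IHus := IHus (alternates_None aus).
elim: u bu aus => [//|l u IHu] /= lu aus.
case: u IHu lu aus => [|l' u] IHu lu aus.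
  rewrite /= IHus; move: aus; case: us {IHus IHu} => [//|[|l' v] us].
    by rewrite alternates_cons.
  rewrite alternates_cons => /and3P[_ ll' _].
  by case: ifP ll' => // /eqP; rewrite /colour /= => ->; rewrite eqxx.
have /andP[/eqP ll' lu'] : (c l' == c l) && monochrome (c l) u by [].
have := IHu; rewrite /colour /= ll' => /(_ lu' aus) ->.
by rewrite ll' eqxx.
Qed.

Lemma size_block_lt us u : all block us -> u \in us -> (1 < size us)%N ->
  (size u < size (flatten us))%N.
Proof.
have block_gt0 v : block v -> (0 < size v)%N by case: v.
move=> bus uus; case/path.splitPr: uus bus => [[|v vs] [|v' vs']] //=.
- by rewrite !size_cat => /and3P[_ /block_gt0 v0 _] _; lia.
- rewrite !flatten_cat !size_cat /= all_cat /= ?size_cat.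
  by move=> /andP[/block_gt0 v0 _] _; lia.
- rewrite !flatten_cat !size_cat /= all_cat /= ?size_cat.
  by move=> /andP[/block_gt0 v0 _] _; lia.
Qed.

(* [cen f us g] evaluates the linear extension of [g] to noncommutative
   polynomials on the product of the centered words u - f(u), u in [us]. *)
Fixpoint cen f us g : K :=
  if us is u :: us' then cen f us' (fun w => g (u ++ w)) - f u * cen f us' g
  else g [::].

Lemma cen_eq f us g g' : g =1 g' -> cen f us g = cen f us g'.
Proof. by move=> /funext->. Qed.

Lemma cenD f us g g' :
  cen f us (fun w => g w + g' w) = cen f us g + cen f us g'.
Proof. by elim: us g g' => //= u us IHus g g'; rewrite !IHus; ring. Qed.

Lemma cenZ f us a g : cen f us (fun w => a * g w) = a * cen f us g.
Proof. by elim: us g => //= u us IHus g; rewrite !IHus; ring. Qed.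

Lemma cenB f us g g' :
  cen f us (fun w => g w - g' w) = cen f us g - cen f us g'.
Proof. by elim: us g g' => //= u us IHus g g'; rewrite !IHus; ring. Qed.

Lemma cen_rcons f us u g : cen f (rcons us u) g =
  cen f us (fun w => g (w ++ u)) - f u * cen f us g.
Proof.
elim: us g => [|v us IHus] g /=; first by rewrite cats0.
rewrite !IHus (@cen_eq _ _ (fun w => g ((v ++ w) ++ u))
  (fun w => g (v ++ w ++ u))) => [|w]; first by ring.
by rewrite catA.
Qed.

Lemma cen_eql f f' us g : {in us, f =1 f'} -> cen f us g = cen f' us g.
Proof.
elim: us g => //= u us IHus g ff'.
rewrite ff' ?mem_head // !IHus // => v vus; by rewrite ff' // inE vus orbT.
Qed.

Lemma cen_eq0 f us g :
  (forall w, (size w <= size (flatten us))%N -> g w = 0) -> cen f us g = 0.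
Proof.
elim: us g => [|u us IHus] g /= g0; first exact: g0.
rewrite !IHus ?mulr0 ?subr0 // => w wus; apply: g0; rewrite !size_cat.
  by rewrite (leq_trans wus) ?leq_addl.
by rewrite leq_add2l.
Qed.

(** In the expansion of the product of the u - f(u), each choice of a constant deletes a nonempty
    block, so the full concatenation is the only term of top length. *)
Lemma cen_top f us g : all block us ->
  (forall w, (size w < size (flatten us))%N -> g w = 0) ->
  cen f us g = g (flatten us).
Proof.
elim: us g => [//|u us IHus] g /= /andP[bu bus] g0.
have u0 : (0 < size u)%N by case: (u) bu.
rewrite IHus // => [|w wus]; last by apply: g0; rewrite !size_cat ltn_add2l.
rewrite cen_eq0 ?mulr0 ?subr0 // => w wus; apply: g0; rewrite size_cat; lia.
Qed.

(** Freeness tested on centered words alone; by linearity this gives freeness of the algebras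
    generated by the letters of each colour, see [word_free_freely_independent]. *)
Definition word_free f := forall us, us != [::] -> alternates None us ->
  cen f us f = 0.

(* Freeness prescribes the value on a word with at least two blocks in terms of
   values on shorter words. *)
Lemma word_free_exists (m : seq L -> K) : m [::] = 1 ->
  exists f,
    [/\ f [::] = 1, forall i w, monochrome i w -> f w = m w & word_free f].
Proof.
move=> m1.
(* The freeness relation is solved for its leading term [f w]. The cutoff at [size w] removes that
   term, and [size_block_lt] makes the centering constants values at shorter words. *)
pose T f w := if (size (blocks w) <= 1)%N then m w else
  - cen f (blocks w) (fun v => if (size v < size w)%N then f v else 0).
have [|f fE] := @contraction_fixpoint L K T (fun=> 0).
  move=> f g w fg; rewrite /T; case: leqP => // w1; congr (- _).
  have [wE aw] := alternates_blocks w.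
  rewrite (@cen_eql _ g) => [|u ubw]; last first.
    apply: fg; rewrite -[w in (_ < size w)%N]wE.
    by rewrite size_block_lt //; case/andP: aw.
  by apply: cen_eq => v; case: ifP => // /fg.
have f1 : f [::] = 1 by rewrite fE.
exists f; split=> // [i w iw|us us0 aus].
  have [->|w0] := eqVneq w [::]; first by rewrite fE.
  have [bw _] := monochrome_block iw w0.
  rewrite fE /T -[w in blocks w]cats0 -[w ++ [::]]/(flatten [:: w]).
  by rewrite blocks_flatten // alternates_cons bw; case/blockP: bw => ? _ ->.
have [us1|us1] := leqP (size us) 1.
  case: us us0 us1 {aus} => [//|u [|//]] _ _ /=.
  by rewrite cats0 f1 mulr1 subrr.
have := fE (flatten us); rewrite /T blocks_flatten // leqNgt us1 /= => /eqP.
rewrite -subr_eq0 opprK => /eqP; rewrite addrC.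
set w := flatten us => <-.
(* The complementary cutoff keeps only words of full length, so [cen_top] evaluates it to [f w]. *)
rewrite -[f w](_ : cen f us
    (fun v => if (size v < size w)%N then 0 else f v) = f w).
  by rewrite -cenD; apply: cen_eq => v; case: ifP; rewrite ?addr0 ?add0r.
rewrite cen_top; first by rewrite -/w ltnn.
  by case/andP: aus.
by move=> v ->.
Qed.

(** A word is a first block of colour [i], possibly empty, followed by alternating blocks. Centering
    the latter changes it by shorter words only, so these products span and induction on the length
    applies. *)
Lemma eq0_of_cen f i g :
  (forall u us, monochrome i u -> alternates (Some i) us ->
     cen f us (fun w => g (u ++ w)) = 0) ->
  forall w, g w = 0.
Proof.
move=> g0 w; have [n] := ubnP (size w); elim: n w => // n IHn w wn.
have [u [us [iu aus wE]]] : exists u us,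
    [/\ monochrome i u, alternates (Some i) us & w = u ++ flatten us].
  have [wE] := alternates_blocks w.
  case: (blocks w) wE => [|u us] /= <- a; first by exists [::], [::].
  have [ui|ui] := eqVneq (Some i) (colour u).
    exists u, us; move: a; rewrite alternates_cons -ui.
    move=> /and3P[/blockP[j ju uj] _ ->].
    by move: uj ju; rewrite -ui => -[->].
  exists [::], (u :: us); split=> //; move: a; rewrite !alternates_cons.
  by rewrite ui => /and3P[-> _ ->].
have := g0 u us iu aus; rewrite cen_top -?wE //; first by case/andP: aus.
move=> v vus; apply: IHn; apply: (@leq_trans (size w)); last by rewrite -ltnS.
by rewrite wE !size_cat ltn_add2l.
Qed.

Section SchwingerDyson.
Variables (f : seq L -> K) (y : L).
Hypotheses (f1 : f [::] = 1) (f_free : word_free f).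

(* The sum of p(U) q(V) over all the factorizations w = U y V. *)
Fixpoint split_sum p q w : K :=
  if w is l :: w' then (l == y)%:R * (p [::] * q w') +
    split_sum (fun u => p (l :: u)) q w'
  else 0.

Lemma split_sum_cat p q u w : split_sum p q (u ++ w) =
  split_sum p (fun v => q (v ++ w)) u + split_sum (fun v => p (u ++ v)) q w.
Proof.
by elim: u p => [|l u IHu] p /=; rewrite ?add0r // IHu addrA.
Qed.

Lemma split_sum_eq0 p q u a : (forall v, all a v -> p v = 0) -> all a u ->
  split_sum p q u = 0.
Proof.
elim: u p => //= l u IHu p p0 /andP[al au]; rewrite p0 // mul0r mulr0 add0r.
by apply: IHu => // v av; rewrite p0 //= al.
Qed.

Lemma split_sum_notin p q u : y \notin u -> split_sum p q u = 0.
Proof.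
elim: u p => //= l u IHu p; rewrite inE negb_or eq_sym => /andP[/negbTE-> yu].
by rewrite mul0r add0r IHu.
Qed.

Lemma split_sumBl a p p' q w :
  split_sum (fun u => p u - a * p' u) q w =
  split_sum p q w - a * split_sum p' q w.
Proof. by elim: w p p' => [|l w IHw] p p' /=; rewrite ?IHw; ring. Qed.

Lemma split_sumZr p q a w :
  split_sum p (fun u => q u * a) w = split_sum p q w * a.
Proof. by elim: w p => [|l w IHw] p /=; rewrite ?IHw; ring. Qed.

Lemma cen_split_sum us p (q : seq L -> seq L -> K) w :
  cen f us (fun v => split_sum p (fun u => q u v) w) =
  split_sum p (fun u => cen f us (q u)) w.
Proof.
elim: w p => [|l w IHw] p /=.
  rewrite (@cen_eq _ _ _ (fun v => 0 * f v)) ?cenZ ?mul0r // => v.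
  by rewrite mul0r.
by rewrite cenD IHw !cenZ.
Qed.

Lemma split_sum_congr p q q' a u : (forall v, all a v -> q v = q' v) ->
  all a u -> split_sum p q u = split_sum p q' u.
Proof.
move=> qq'; elim: u p => //= l u IHu p /andP[al au].
by rewrite IHu // qq'.
Qed.

(** In u = (u - f(u)) + f(u), the first summand extends the alternating product and is killed by
    freeness. *)
Lemma cen_free_prefix i u us : monochrome i u -> alternates (Some i) us ->
  cen f us (fun w => f (u ++ w)) = f u * cen f us f.
Proof.
move=> iu ius; have [->|u0] := eqVneq u [::].
  by rewrite f1 mul1r; apply: cen_eq.
have [bu ui] := monochrome_block iu u0.
apply/eqP; rewrite -subr_eq0 -/(cen f (u :: us) f); apply/eqP/f_free => //.
by rewrite alternates_cons bu ui.
Qed.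

Lemma cen_free i us : alternates (Some i) us -> us != [::] -> cen f us f = 0.
Proof. by move=> /alternates_None ius us0; apply: f_free. Qed.

Lemma cen_free_prefix2 i j v u us : (v != [::] -> i != j) -> monochrome j v ->
  monochrome i u -> alternates (Some i) us ->
  cen f us (fun w => f (v ++ u ++ w)) = f u * cen f us (fun w => f (v ++ w)).
Proof.
move=> ij jv iu ius; have [->|u0] := eqVneq u [::].
  by rewrite f1 mul1r; apply: cen_eq.
have [->|v0] := eqVneq v [::].
  by rewrite (cen_free_prefix iu ius).
have [bu ui] := monochrome_block iu u0.
have [bv vj] := monochrome_block jv v0.
have aus : alternates (Some j) (u :: us).
  by rewrite alternates_cons bu ui ius andbT /= (inj_eq Some_inj) eq_sym ij.
have avus : alternates None (v :: u :: us).
  by rewrite alternates_cons bv vj aus.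
have := f_free (isT : v :: u :: us != [::]) avus.
rewrite [LHS]/= -/(cen f us f).
rewrite -/(cen f (u :: us) f) (cen_free aus) // mulr0 subr0.
by move=> /eqP; rewrite subr_eq0 => /eqP.
Qed.

(** The product over [us] begins and ends in colours other than [i], the block [x] recording the
    latter. So [u] and [v] can be centered on either side of it, and every term vanishes by
    freeness. *)
Lemma cen_free_sandwich i u v us x : monochrome i u -> monochrome i v ->
  us != [::] -> block x -> colour x = Some i ->
  alternates (Some i) (rcons us x) ->
  cen f us (fun w => f (u ++ w ++ v)) = 0.
Proof.
move=> iu iv us0 bx xi; rewrite /alternates all_rcons map_rcons xi.
move=> /andP[/andP[_ bus]]; rewrite rcons_path => /andP[pus lus].
have ius : alternates (Some i) us by rewrite /alternates bus.
have usf : cen f us (fun w => f (u ++ w)) = 0.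
  by rewrite (cen_free_prefix iu ius) (cen_free ius) ?mulr0.
have [->|v0] := eqVneq v [::].
  by rewrite -[RHS]usf; apply: cen_eq => w; rewrite cats0.
have [bv vi] := monochrome_block iv v0.
have iusv : alternates (Some i) (rcons us v).
  by rewrite /alternates all_rcons map_rcons vi bv bus rcons_path pus.
have := cen_free_prefix iu iusv; rewrite (cen_free iusv) ?mulr0.
  by rewrite cen_rcons usf mulr0 subr0.
by case: (us) us0.
Qed.

(** A letter [y] of the centered product lies in a block of colour [c y], behind at least one block
    of another colour. The factor to its left thus has the form treated in [cen_free_sandwich] and
    vanishes. The induction moves the blocks already passed into [vs]. *)
Lemma cen_split_sum_eq0 q u vs us :
  monochrome (c y) u -> alternates (Some (c y)) (vs ++ us) ->
  cen f us (split_sum (fun v => cen f vs (fun w => f (u ++ w ++ v))) q) = 0.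
Proof.
move=> yu; elim: us vs => [//|x us IHus] vs avs.
set p := fun v => _.
have px q' : split_sum p q' x = 0.
  have [yx|/split_sum_notin//] := boolP (y \in x).
  move: avs; rewrite /alternates all_cat map_cat cat_path /=.
  move=> /andP[/andP[bvs /andP[bx _]]] /andP[pvs /andP[vsx _]].
  have [j jx xj] := blockP _ bx.
  have xy : colour x = Some (c y) by rewrite xj -(eqP (allP jx _ yx)).
  have vs0 : vs != [::] by case: (vs) vsx; rewrite // xy eqxx.
  apply: (@split_sum_eq0 _ _ _ (fun l => c l == c y)) => [v yv|].
    apply: (@cen_free_sandwich (c y) _ _ _ x) => //.
    by rewrite /alternates all_rcons map_rcons bx bvs rcons_path pvs.
  by move: xj jx; rewrite xy => -[->].
rewrite /= (@cen_eq _ _ _ (split_sum (fun v => p (x ++ v)) q)) => [|w].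
  rewrite -cenZ -cenB -[RHS](IHus (rcons vs x)) ?cat_rcons //.
  apply: cen_eq => w; rewrite -split_sumBl; congr split_sum.
  apply/funext => v; rewrite cen_rcons; congr (_ - _); apply: cen_eq => w'.
  by rewrite !catA.
by rewrite split_sum_cat px add0r.
Qed.

(** Tested on [u] times a centered product, with [u] of the colour of [y]. On the left, [y :: u] is
    a single block whose value factors out and is given by the hypothesis. On the right, only the
    letters [y] inside [u] contribute, and the same factor comes out of their terms. *)
Theorem word_schwinger_dyson (t : K) j v :
  (forall w, monochrome (c y) w -> f (y :: w) = t * split_sum f f w) ->
  (v != [::] -> c y != j) -> monochrome j v ->
  forall w, f (v ++ y :: w) = t * split_sum f (fun u => f (v ++ u)) w.
Proof.
move=> sdy yj jv w; apply/eqP; rewrite -subr_eq0; apply/eqP; move: w.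
apply: (@eq0_of_cen f (c y)) => u us yu aus; rewrite cenB cenZ.
rewrite (@cen_free_prefix2 (c y) j v (y :: u)) //=; last first.
  by rewrite /= eqxx.
rewrite sdy // -mulrA -mulrBr.
rewrite [X in _ - X](@cen_eq _ _ _ (fun w =>
    split_sum f (fun u' => f (v ++ u' ++ w)) u +
    split_sum (fun u' => f (u ++ u')) (fun u' => f (v ++ u')) w)) => [|w].
  rewrite cenD cen_split_sum.
  rewrite (@cen_split_sum_eq0 _ u [::]) // addr0.
  rewrite [X in _ - X](@split_sum_congr _ _
    (fun u' => f u' * cen f us (fun w => f (v ++ w)))
    (fun l => c l == c y)) // => [|u' yu'];
    last exact: (@cen_free_prefix2 (c y) j).
  by rewrite split_sumZr subrr mulr0.
by rewrite split_sum_cat.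
Qed.

End SchwingerDyson.

End Words.

(** * Freeness in a noncommutative probability space *)

Local Open Scope classical_set_scope.
Local Open Scope complex_scope.

Section WordMoments.
Context (R : realType) (A : ncprob R) (L I : eqType) (c : L -> I) (x : L -> A).
Implicit Types (a b : A) (u w : seq L) (us : seq (seq L)).

Definition word_moment w : R[i] := ncp_phi A (\prod_(l <- w) x l).

Definition centered_word u : A := \prod_(l <- u) x l - (word_moment u)%:A.

Lemma word_moment_nil : word_moment [::] = 1.
Proof. by rewrite /word_moment big_nil ncp_phi1. Qed.

Lemma phi_centered_word u : ncp_phi A (centered_word u) = 0.
Proof. by rewrite linearB linearZ /= ncp_phi1 /word_moment mulr1 subrr. Qed.

Lemma phi_prod_centered us b :
  ncp_phi A (b * \prod_(u <- us) centered_word u) =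
  cen word_moment us (fun w => ncp_phi A (b * \prod_(l <- w) x l)).
Proof.
elim: us b => [|u us IHus] b /=; first by rewrite !big_nil.
rewrite big_cons mulrA /centered_word mulrBr mulrBl linearB.
rewrite -scalerAr mulr1 -scalerAl linearZ -/(centered_word _) /= !IHus.
congr (_ - _); apply: cen_eq => w.
by rewrite big_cat /= mulrA.
Qed.

Lemma phi_centered_words us :
  ncp_phi A (\prod_(u <- us) centered_word u) = cen word_moment us word_moment.
Proof.
rewrite -[X in ncp_phi A X]mul1r phi_prod_centered.
by apply: cen_eq => w; rewrite mul1r.
Qed.

Lemma gen_subalgebra_centered_word (S : set A) u :
  (forall l, l \in u -> S (x l)) -> gen_subalgebra S (centered_word u).
Proof.
move=> Su M [[M1 Mlin Mmul] SM].
have M0 : M 0 by rewrite -[0](addNr 1) -scaleN1r; exact: Mlin.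
rewrite /centered_word addrC -scaleNr; apply: Mlin => //.
rewrite big_seq; elim/big_ind: _ => // l lu.
exact/SM/Su.
Qed.

Lemma freely_independent_word_free (S : I -> set A) :
  (forall l, S (c l) (x l)) -> freely_independent S -> word_free c word_moment.
Proof.
move=> Sx freeS us us0 aus; rewrite -phi_centered_words.
rewrite (big_nth [::]).
have /andP[bus pus] := aus.
case: us us0 aus bus pus => [//|u0 us] _ _.
set vs := u0 :: us => bus pus.
have [i0 _ u0i] := blockP _ _ (andP bus).1.
(* [freely_independent] wants a colour at every natural number; [i0] fills the positions past the
   end. *)
pose i j := odflt i0 (colour c (nth [::] vs j)).
have iE j : (j < size vs)%N ->
    monochrome c (i j) (nth [::] vs j) /\ colour c (nth [::] vs j) = Some (i j).
  move=> jvs; have [d du uE] := blockP _ _ (allP bus _ (mem_nth [::] jvs)).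
  by rewrite /i uE.
apply: (freeS _ i) => // j jn.
- apply: gen_subalgebra_centered_word => l lu.
  by have [/allP/(_ _ lu)/eqP <- _] := iE j jn.
- exact: phi_centered_word.
- move/(pathP None): pus => /(_ j.+1); rewrite size_map => /(_ jn).
  have jn' : (j < size vs)%N := ltnW jn.
  rewrite -[nth _ (_ :: _) _]/(nth None (map (colour c) vs) j).
  rewrite !(nth_map [::]) //.
  have [_ ->] := iE _ jn'; have [_ ->] := iE _ jn.
  by move=> /eqP H H'; apply: H; rewrite H'.
Qed.

Definition centered_span i : set A := [set a |
  exists2 r : seq (R[i] * seq L), all (fun z => block c z.2 &&
     (colour c z.2 == Some i)) r & a = \sum_(z <- r) z.1 *: centered_word z.2].

Definition word_span i : set A := [set a |
  exists2 r : seq (R[i] * seq L), all (fun z => monochrome c i z.2) r &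
    a = \sum_(z <- r) z.1 *: \prod_(l <- z.2) x l].

Lemma gen_subalgebra_span (S : set A) i a :
  (forall b, S b -> exists2 l, c l = i & b = x l) ->
  gen_subalgebra S a -> word_span i a.
Proof.
move=> Sx ga; apply: (ga (word_span i)); split=> [|b /Sx[l li ->]] /=;
  last first.
  by exists [:: (1, [:: l])]; rewrite /= ?li ?eqxx // !big_seq1 scale1r.
split.
- by exists [:: (1, [::])]; rewrite // big_seq1 big_nil scale1r.
- move=> k _ _ [r ri ->] [s si ->].
  exists ([seq (k * z.1, z.2) | z <- r] ++ s).
    by rewrite all_cat si andbT all_map; apply: sub_all ri.
  rewrite big_cat big_map scaler_sumr; congr (_ + _).
  by apply: eq_bigr => z _ /=; rewrite scalerA.
- move=> _ _ [r ri ->] [s si ->].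
  exists [seq (z.1 * z'.1, z.2 ++ z'.2) | z <- r, z' <- s].
    apply/allP => z /allpairsP[[z1 z2] [/= z1r z2s ->]] /=.
    rewrite /monochrome all_cat; apply/andP.
    by split; [apply: (allP ri)|apply: (allP si)].
  rewrite big_allpairs_dep mulr_suml; apply: eq_bigr => z _.
  rewrite mulr_sumr; apply: eq_bigr => z' _ /=.
  by rewrite big_cat /= -scalerAl -scalerAr scalerA.
Qed.

(** Replacing every word by its centered form subtracts the scalar phi(a), which is zero; the empty
    word then drops out, its centered form being zero. *)
Lemma gen_subalgebra_centered_span (S : set A) i a :
  (forall b, S b -> exists2 l, c l = i & b = x l) ->
  gen_subalgebra S a -> ncp_phi A a = 0 -> centered_span i a.
Proof.
move=> Sx /(gen_subalgebra_span Sx)[r ri ->] r0.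
exists [seq z <- r | z.2 != [::]].
  rewrite all_filter; apply: sub_all ri => z zi; apply/implyP => z0.
  by have [-> ->] := monochrome_block zi z0; rewrite eqxx.
transitivity (\sum_(z <- r) z.1 *: centered_word z.2).
  rewrite /centered_word.
  under [RHS]eq_bigr do rewrite scalerBr scalerA.
  rewrite sumrB -scaler_suml (_ : \sum_(z <- r) _ = 0) ?scale0r ?subr0 //.
  rewrite -[RHS]r0 linear_sum; apply: eq_bigr => z _.
  by rewrite linearZ.
rewrite big_filter [RHS]big_mkcond; apply: eq_bigr => z _; case: eqP => //= ->.
by rewrite /centered_word word_moment_nil big_nil scale1r subrr scaler0.
Qed.

Lemma word_free_freely_independent (S : I -> set A) :
  (forall i b, S i b -> exists2 l, c l = i & b = x l) ->
  word_free c word_moment -> freely_independent S.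
Proof.
move=> Sx wf n i a n0 ga pa di.
have {ga pa} ca j : (j < n)%N -> centered_span (i j) (a j).
  move=> jn; apply: (gen_subalgebra_centered_span (Sx _)); first exact: ga.
  exact: pa.
(* Generalized over a prefix of centered words, so that the factors [a j] are expanded one at a time
   and absorbed into it. *)
suff H us : alternates c None us ->
    (0 < n)%N -> last None (map (colour c) us) != Some (i 0) ->
    ncp_phi A (\prod_(u <- us) centered_word u * \prod_(0 <= j < n) a j) = 0.
  by have := H [::] isT n0 isT; rewrite big_nil mul1r.
elim: n i a {n0} di ca us => [//|n IHn] i a di ca us /andP[bus pus] _ usi.
rewrite big_nat_recl //; have [r ri ->] := ca 0 isT.
rewrite mulr_suml mulr_sumr linear_sum big_seq big1 // => z zr.
rewrite -scalerAl -scalerAr linearZ /= mulrA.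
rewrite (_ : \prod_(u <- us) _ * _ = \prod_(u <- rcons us z.2) centered_word u).
  have /andP[bz /eqP zi] := allP ri _ zr.
  have az : alternates c None (rcons us z.2).
    by rewrite /alternates all_rcons bz bus map_rcons rcons_path pus zi.
  case: n IHn di ca => [|n] IHn di ca.
    rewrite big_nil mulr1 phi_centered_words wf ?mulr0 //.
    by case: (us).
  rewrite (IHn (i \o succn) (a \o succn)) ?mulr0 //.
  - by move=> j jn; apply: di.
  - by move=> j jn; apply: ca.
  - rewrite map_rcons last_rcons zi; apply/eqP => -[].
    exact: di.
by rewrite -cats1 big_cat big_seq1.
Qed.

End WordMoments.

(** A free family with prescribed marginals lives on the algebra of polynomials in all its letters:
    freeness is a property of the functional, which [word_free_exists] supplies. *)
Lemma word_free_model (R : realType) (I : eqType) (n : nat) (c : 'I_n -> I)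
    (m : seq 'I_n -> R[i]) : m [::] = 1 ->
  exists (A : ncprob R) (x : 'I_n -> A),
    (forall i w, monochrome c i w -> word_moment x w = m w) /\
    word_free c (word_moment x).
Proof.
move=> m1; have [f [f1 fm ff]] := word_free_exists c m1.
have [F FE] := scalar_ncpoly_exists f.
have F1 : F 1 = 1 by rewrite -f1 -FE big_nil.
exists (@NCProb R (ncpoly R[i] n) F F1), ncX.
have E : word_moment (A := @NCProb R (ncpoly R[i] n) F F1) ncX = f.
  exact/funext/FE.
by rewrite E.
Qed.

(** * Moments of the semicircular law *)

Section Semicircle.
Context (R : realType).
Implicit Types (a b t x u : R) (F f : R -> R).
Local Notation mu := (@lebesgue_measure R).

Lemma continuous_itv_integrable f a b : continuous f ->
  mu.-integrable `[a, b] (EFin \o f).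
Proof.
move=> cf; apply: continuous_compact_integrable; first exact: segment_compact.
exact: continuous_subspaceT.
Qed.

Lemma Rintegral_FTC2 F f a b : a < b -> continuous F -> continuous f ->
  (forall x, a < x < b -> is_derive x 1 F (f x)) ->
  \int[mu]_(x in `[a, b]) f x = F b - F a.
Proof.
move=> ab cF cf dF; rewrite /Rintegral (@continuous_FTC2 _ f F) //.
- exact: continuous_subspaceT.
- split.
  + by move=> x; rewrite in_itv/= => /dF [].
  + exact: cvg_at_right_filter (cF a).
  + exact: cvg_at_left_filter (cF b).
- by move=> x; rewrite in_itv/= => /dF ?; rewrite derive1E derive_val.
Qed.

Lemma is_derive_ext F f x df df' : is_derive x 1 F df' -> F =1 f -> df' = df ->
  is_derive x 1 f df.
Proof. by move=> dF /funext <- <-. Qed.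

Section Radius.
Variables (a : R) (a0 : 0 < a).

Definition halfcircle u : R := Num.sqrt (a ^+ 2 - u ^+ 2).

Lemma continuous_halfcircle : continuous halfcircle.
Proof.
move=> u; apply: (@continuous_comp _ _ _ (fun u => a ^+ 2 - u ^+ 2) Num.sqrt).
  apply: cvgB; first exact: cvg_cst.
  exact: exprn_continuous.
exact: sqrt_continuous.
Qed.

Lemma halfcircle_gt0 u : - a < u < a -> 0 < halfcircle u.
Proof. by move=> ua; rewrite sqrtr_gt0 subr_gt0; nra. Qed.

Lemma sqr_halfcircle u : - a <= u <= a -> halfcircle u ^+ 2 = a ^+ 2 - u ^+ 2.
Proof. by move=> ua; rewrite sqr_sqrtr // subr_ge0; nra. Qed.

Lemma is_derive_halfcircle u : - a < u < a ->
  is_derive u 1 halfcircle (- u / halfcircle u).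
Proof.
move=> ua; have r0 := halfcircle_gt0 ua.
have d1 : is_derive (a ^+ 2 - u ^+ 2) 1 Num.sqrt (2 * halfcircle u)^-1.
  by apply: is_derive1_sqrt; rewrite -sqrtr_gt0.
have d2 : is_derive u 1 (cst (a ^+ 2) - id ^+ 2 : R -> R) (- (2 * u)).
  by apply: is_derive_eq; rewrite /= expr1 /GRing.scale /= mulr1 sub0r.
have d := @is_derive1_comp R Num.sqrt (cst (a ^+ 2) - id ^+ 2) u _ _ d1 d2.
rewrite (_ : - u / _ = (2 * halfcircle u)^-1 * - (2 * u)); first exact: d.
by field; rewrite gt_eqF.
Qed.

Lemma continuous_exprM_halfcircle n :
  continuous (fun u => u ^+ n * halfcircle u).
Proof.
move=> u; apply: cvgM; first exact: exprn_continuous.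
exact: continuous_halfcircle.
Qed.

Definition halfcircle_moment n : R :=
  \int[mu]_(u in `[- a, a]) (u ^+ n * halfcircle u).

(** Between -a and a this is x^n times the cube of [halfcircle]. The extra square cancels the
    denominator in the derivative of [halfcircle], which leaves integrands of moments, and it makes
    the boundary terms vanish. *)
Lemma is_derive_exprM_halfcircle n u : - a < u < a ->
  is_derive u 1 (fun x => x ^+ n * (a ^+ 2 - x ^+ 2) * halfcircle x)
    (n%:R * u ^+ n.-1 * (a ^+ 2 - u ^+ 2) * halfcircle u -
     3 * (u ^+ n.+1 * halfcircle u)).
Proof.
move=> ua; have r0 := halfcircle_gt0 ua.
have := sqr_halfcircle (u := u); rewrite !ltW //=; last 2 first.
- by case/andP: ua.
- by case/andP: ua.
move=> /(_ isT) r2.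
have dr := is_derive_halfcircle ua.
have dn m : is_derive u 1 (id ^+ m : R -> R) _ :=
  @is_deriveX _ _ _ m u 1 _ (is_derive_id u 1).
have d := is_deriveM (is_deriveM (dn n)
  (is_deriveB (is_derive_cst (a ^+ 2) u 1) (dn 2%N))) dr.
apply: (is_derive_ext d) => [x|]; first by rewrite !fctE.
rewrite !fctE /GRing.scale /= !mulr1 sub0r expr1 -r2 [u ^+ n.+1]exprS.
by field; rewrite gt_eqF.
Qed.

Lemma halfcircle_moment_rec n :
  n.+4%:R * halfcircle_moment n.+2 = a ^+ 2 * n.+1%:R * halfcircle_moment n.
Proof.
have ci m := continuous_itv_integrable (- a) a (@continuous_exprM_halfcircle m).
pose F x := x ^+ n.+1 * (a ^+ 2 - x ^+ 2) * halfcircle x.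
have : \int[mu]_(u in `[- a, a]) (a ^+ 2 * n.+1%:R * (u ^+ n * halfcircle u) -
    n.+4%:R * (u ^+ n.+2 * halfcircle u)) = F a - F (- a).
  apply: Rintegral_FTC2.
  - by rewrite gtrN.
  - move=> u; apply: cvgM; last exact: continuous_halfcircle.
    apply: cvgM; first exact: exprn_continuous.
    by apply: cvgB; [exact: cvg_cst|exact: exprn_continuous].
  - move=> u; apply: cvgB; apply: cvgM;
      by [exact: cvg_cst|exact: continuous_exprM_halfcircle].
  - move=> u ua; apply: is_derive_eq (is_derive_exprM_halfcircle n.+1 ua) _.
    by rewrite /= !exprS; ring.
rewrite RintegralB //; last 2 first.
- apply: continuous_itv_integrable => u.
  by apply: cvgM; [exact: cvg_cst|exact: continuous_exprM_halfcircle].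
- apply: continuous_itv_integrable => u.
  by apply: cvgM; [exact: cvg_cst|exact: continuous_exprM_halfcircle].
rewrite !RintegralZl //.
rewrite /F sqrrN subrr !mulr0 !mul0r subrr => /eqP.
by rewrite subr_eq0 => /eqP <-.
Qed.

Lemma halfcircle_moment1 : halfcircle_moment 1 = 0.
Proof.
have ci m := continuous_itv_integrable (- a) a (@continuous_exprM_halfcircle m).
pose F x := x ^+ 0 * (a ^+ 2 - x ^+ 2) * halfcircle x.
have : \int[mu]_(u in `[- a, a]) (- 3 * (u ^+ 1 * halfcircle u)) =
    F a - F (- a).
  apply: Rintegral_FTC2.
  - by rewrite gtrN.
  - move=> u; apply: cvgM; last exact: continuous_halfcircle.
    apply: cvgM; first exact: exprn_continuous.
    by apply: cvgB; [exact: cvg_cst|exact: exprn_continuous].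
  - move=> u; apply: cvgM;
      by [exact: cvg_cst|exact: continuous_exprM_halfcircle].
  - move=> u ua; apply: is_derive_eq (is_derive_exprM_halfcircle 0 ua) _.
    by rewrite !mul0r sub0r mulNr.
rewrite RintegralZl //.
rewrite /F sqrrN subrr !mulr0 !mul0r subrr => /eqP.
by rewrite mulf_eq0 oppr_eq0 pnatr_eq0 => /eqP.
Qed.

Lemma halfcircle_moment0 : halfcircle_moment 0 = pi * a ^+ 2 / 2.
Proof.
(* [atan (v x)] is half the angle whose sine is x / a, so [F] below is the classical primitive with
   arcsin. The denominator never vanishes, whence the continuity on the whole line that
   [Rintegral_FTC2] asks for. *)
pose v x := x / (a + halfcircle x).
have ar x : a + halfcircle x != 0.
  by rewrite gt_eqF // ltr_pwDl // sqrtr_ge0.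
pose F x := x * halfcircle x / 2 + a ^+ 2 * atan (v x).
have cv : continuous v.
  move=> x; apply: cvgM; first exact: cvg_id.
  apply: cvgV; first exact: ar.
  apply: cvgD; first exact: cvg_cst.
  exact: continuous_halfcircle.
transitivity (F a - F (- a)); last first.
  have rN : halfcircle (- a) = 0 by rewrite /halfcircle sqrrN subrr sqrtr0.
  have r : halfcircle a = 0 by rewrite /halfcircle subrr sqrtr0.
  rewrite /F /v r rN !mulr0 !mul0r !add0r !addr0 mulNr divff ?gt_eqF //.
  rewrite atanN atan1.
  by field.
apply: Rintegral_FTC2.
- by rewrite gtrN.
- move=> x; apply: cvgD; apply: cvgM.
  + by apply: cvgM; [exact: cvg_id|exact: continuous_halfcircle].
  + exact: cvg_cst.
  + exact: cvg_cst.
  + apply: (@continuous_comp _ _ _ v atan); first exact: cv.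
    exact: continuous_atan.
- exact: continuous_exprM_halfcircle.
- move=> u ua; have r0 := halfcircle_gt0 ua.
  have := sqr_halfcircle (u := u); rewrite !ltW //=; last 2 first.
  + by case/andP: ua.
  + by case/andP: ua.
  move=> /(_ isT) r2.
  have u2 : u ^+ 2 = a ^+ 2 - halfcircle u ^+ 2 by rewrite r2 subKr.
  have dr := is_derive_halfcircle ua.
  have dv : is_derive u 1 v (a / (halfcircle u * (a + halfcircle u))).
    have dV := @is_deriveV R (cst a + halfcircle) u _ 1 (ar u)
      (is_deriveD (is_derive_cst _ _ _) dr).
    apply: (is_derive_ext (is_deriveM (is_derive_id u 1) dV)) => //.
    rewrite /GRing.scale /=.
    rewrite -[(cst a + halfcircle) u]/(a + halfcircle u).
    transitivity ((u ^+ 2 + halfcircle u * (a + halfcircle u)) /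
      (halfcircle u * (a + halfcircle u) ^+ 2)).
      by field; rewrite ar gt_eqF.
    by rewrite u2; field; rewrite ar gt_eqF.
  have da := is_derive1_comp (is_derive1_atan (v u)) dv.
  have d := is_deriveD
    (is_deriveM (is_deriveM (is_derive_id u 1) dr)
      (is_derive_cst (2^-1 : R) u 1))
    (is_deriveM (is_derive_cst (a ^+ 2) u 1) da).
  apply: (is_derive_ext d) => //.
  rewrite /GRing.scale /=.
  have v2 : 1 + v u ^+ 2 = 2 * a / (a + halfcircle u).
    by rewrite /v expr_div_n u2; field.
  rewrite v2 !mulr0 add0r addr0 expr0 mul1r mulr1.
  rewrite (_ : u * (- u / halfcircle u) = - u ^+ 2 / halfcircle u);
    last by ring.
  rewrite u2.
  by field; rewrite ar !gt_eqF.
Qed.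

End Radius.

Lemma semicircle_moment_halfcircle t n : 0 < t ->
  semicircle_moment t n =
  halfcircle_moment (2 * Num.sqrt t) n / (2 * pi * t).
Proof.
move=> t0; rewrite /semicircle_moment /halfcircle_moment -RintegralZr //.
  apply: eq_Rintegral => u _.
  by rewrite /halfcircle exprMn sqr_sqrtr ?ltW // mulrA -natrX.
exact/continuous_itv_integrable/continuous_exprM_halfcircle.
Qed.

Section SemicircleMoments.
Variables (t : R) (t0 : 0 < t).
Local Notation m := (semicircle_moment t).

Let a0 : 0 < 2 * Num.sqrt t. Proof. by rewrite mulr_gt0 // sqrtr_gt0. Qed.
Let a2 : (2 * Num.sqrt t) ^+ 2 = 4 * t.
Proof. by rewrite exprMn sqr_sqrtr ?ltW // -natrX. Qed.

Lemma semicircle_moment0 : m 0 = 1.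
Proof.
rewrite semicircle_moment_halfcircle // halfcircle_moment0 // a2.
move: (@pi R) (lt0r_neq0 (pi_gt0 R)) => p p0.
by field; rewrite p0 gt_eqF.
Qed.

Lemma semicircle_moment1 : m 1 = 0.
Proof.
by rewrite semicircle_moment_halfcircle // halfcircle_moment1 // mul0r.
Qed.

Lemma semicircle_moment_rec n : n.+4%:R * m n.+2 = 4 * t * n.+1%:R * m n.
Proof.
rewrite !semicircle_moment_halfcircle // mulrA halfcircle_moment_rec //.
by rewrite a2 mulrA.
Qed.

Let S n := \sum_(i < n.+1) m i * m (n - i)%N.

Lemma semicircle_conv_weighted n :
  2 * \sum_(i < n.+1) i%:R * (m i * m (n - i)%N) = n%:R * S n.
Proof.
rewrite mulr2n mulrDl mul1r {2}(reindex_inj rev_ord_inj) -big_split mulr_sumr.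
apply: eq_bigr => -[i iN] _ /=.
rewrite subSS subKn // [m (n - i)%N * m i]mulrC -mulrDl -natrD subnKC //.
Qed.

(* Weighting the convolution by [i + 4] turns the three-term ratio of the
   moments into a recursion for the convolution itself. *)
Lemma semicircle_moment_conv n : m n.+2 = t * \sum_(i < n.+1) m i * m (n - i)%N.
Proof.
rewrite -/(S n).
have step p : (p + 6)%:R * S p.+2 = 4 * t * (p + 2)%:R * S p + 4 * m p.+2.
  have E1 : \sum_(i < p.+1) (i.+4%:R * m i.+2) * m (p - i)%N =
      2 * t * (p + 2)%:R * S p.
    under eq_bigr do rewrite semicircle_moment_rec.
    have -> : 2 * t * (p + 2)%:R * S p =
       2 * t * (2 * \sum_(i < p.+1) i%:R * (m i * m (p - i)%N)) + 4 * t * S p.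
      by rewrite semicircle_conv_weighted natrD; ring.
    rewrite /S !mulr_sumr -big_split.
    by apply: eq_bigr => i _ /=; rewrite -natr1; ring.
  have : \sum_(i < p.+3) (i%:R + 2) * (m i * m (p.+2 - i)%N) =
      2 * m p.+2 + 2 * t * (p + 2)%:R * S p.
    rewrite 2!big_ord_recl /= semicircle_moment0 semicircle_moment1 -E1.
    rewrite mul0r mulr0 add0r subn0 add0r mul1r; congr (_ + _).
    apply: eq_bigr => i _.
    rewrite /bump /= !add1n !subSS mulrA; congr (_ * _ * _).
    by rewrite -natrD addn2.
  under eq_bigr do rewrite mulrDl.
  rewrite big_split -mulr_sumr /= => /(congr1 (fun x => 2 * x)).
  rewrite mulrDr semicircle_conv_weighted -/(S p.+2) => E.
  have -> : (p + 6)%:R * S p.+2 = p.+2%:R * S p.+2 + 2 * (2 * S p.+2).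
    by rewrite -addn2 !natrD; ring.
  by rewrite E; ring.
have [n2] := ubnP n; elim: n2 n => // n2 IH [|[|n]] nn.
- rewrite /S big_ord1 semicircle_moment0 !mulr1.
  have := semicircle_moment_rec 0; rewrite semicircle_moment0 => h; lra.
- rewrite /S big_ord_recl big_ord1 /= semicircle_moment0 semicircle_moment1.
  have := semicircle_moment_rec 1; rewrite semicircle_moment1 => h; lra.
(* With m_{n+2} = t S_n by induction, [step n] becomes (n+6) S_{n+2} = 4 (n+3) m_{n+2}, while the
   moments satisfy (n+6) m_{n+4} = 4 t (n+3) m_{n+2}. *)
- have h1 := step n; have h2 := semicircle_moment_rec n.+2.
  have h3 : m n.+2 = t * S n by apply: IH; lia.
  have {}h1 : (n + 6)%:R * S n.+2 = 4 * (n + 2)%:R * m n.+2 + 4 * m n.+2.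
    by rewrite h1 h3; ring.
  apply: (@mulfI _ (n + 6)%:R); first by rewrite pnatr_eq0 addn_eq0 andbF.
  rewrite mulrCA h1 (_ : (n + 6)%:R = n.+2.+4%:R) ?h2; last by congr _%:R; lia.
  have -> : n.+3%:R = (n + 2)%:R + 1 :> R by rewrite natr1 addn2.
  by ring.
Qed.

End SemicircleMoments.

End Semicircle.

(** * Convolution with a semicircular family *)

Lemma split_sum_map (K : comNzRingType) (L L' : eqType) (h : L -> L') (y : L)
    (p q : seq L' -> K) w : injective h ->
  split_sum (h y) p q (map h w) =
  split_sum y (fun u => p (map h u)) (fun u => q (map h u)) w.
Proof.
move=> hI; elim: w p => //= l w IHw p.
by rewrite IHw (inj_eq hI).
Qed.

Lemma split_sumD (K : comNzRingType) (L : eqType) (y : L)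
    (p p' q : seq L -> K) w :
  split_sum y (fun u => p u + p' u) q w =
  split_sum y p q w + split_sum y p' q w.
Proof. by elim: w p p' => [|l w IHw] p p' /=; rewrite ?IHw; ring. Qed.

Lemma nccoef_split_sum (K : comNzRingType) (k : nat) (y : 'I_k)
    (p q : ncseries K k) w :
  nccoef (p * (ncZ y * q)) w = split_sum y (nccoef p) (nccoef q) w.
Proof.
elim: w p => [|l w IHw] p; first by rewrite nccoefM0 nccoefZl mulr0.
transitivity (nccoef (lderiv l p * (ncZ y * q)) w +
    nccoef p [::] * nccoef (ncZ y * q) (l :: w)).
  by rewrite -[LHS]/(nccoef (lderiv l _) w) lderivM.
by rewrite IHw nccoefZl addrC mulrCA.
Qed.

Lemma split_sum_nseq (K : comNzRingType) (L : eqType) (y : L)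
    (p q : seq L -> K) n :
  split_sum y p q (nseq n y) =
  \sum_(i < n) p (nseq i y) * q (nseq (n - i.+1) y).
Proof.
elim: n p => [|n IHn] p /=; first by rewrite big_ord0.
rewrite big_ord_recl eqxx mul1r IHn /= subSS subn0; congr (_ + _).
Qed.

Section Gamma.
Context (R : realType) (k : nat) (t : R) (t0 : 0 < t).

Lemma gamma_model : exists (A : ncprob R) (x : 'I_k -> A),
  [/\ freely_independent (fun i => [set x i]), forall i, semicircular t (x i)
    & has_joint_distribution x (gamma k t)].
Proof.
apply: (@getPex _ [set rho | exists (A : ncprob R) (x : 'I_k -> A),
    [/\ freely_independent (fun i => [set x i]), forall i, semicircular t (x i)
      & has_joint_distribution x rho]]).
(* With each letter as its own colour, the monochromatic words are the powers of a letter, so [m]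
   prescribes the moments of each variable. *)
pose m (w : seq 'I_k) : R[i] := (semicircle_moment t (size w))%:C.
have [|A [x [xm xf]]] := @word_free_model R _ k id m.
  by rewrite /m semicircle_moment0.
have [|rho rhoE] := @Dalg_exists R k (word_moment x).
  exact: word_moment_nil.
exists rho, A, x; split=> //.
- by apply: (word_free_freely_independent _ xf) => i b /= ->; exists i.
- move=> i n; rewrite -[n in RHS](size_nseq n i) -/(m (nseq n i)).
  rewrite -(xm i) ?/word_moment ?big_nseq ?iter_mulr_1 //.
  by rewrite /monochrome all_nseq eqxx orbT.
Qed.

(** On powers of [y] this is the convolution recursion of the semicircular moments;
    [word_schwinger_dyson] with an empty prefix extends it to all words. *)
Lemma gamma_schwinger_dyson y w :
  gamma k t (\prod_(i <- y :: w) ncX i) =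
  t%:C * split_sum y (fun u => gamma k t (\prod_(i <- u) ncX i))
    (fun u => gamma k t (\prod_(i <- u) ncX i)) w.
Proof.
have [A [x [xf xs xd]]] := gamma_model.
have -> : (fun u => gamma k t (\prod_(i <- u) ncX i)) = word_moment x.
  exact/funext.
rewrite xd -[LHS]/(word_moment x ([::] ++ y :: w)).
have xwf : word_free id (word_moment x).
  exact: (freely_independent_word_free _ xf).
apply: (word_schwinger_dyson (word_moment_nil x) xwf (j := y)) => // u.
move=> /all_pred1P ->; set n := size u.
have mE j : word_moment x (nseq j y) = (semicircle_moment t j)%:C.
  by rewrite -(xs y) /word_moment big_nseq iter_mulr_1.
rewrite -[_ :: _]/(nseq n.+1 y) mE split_sum_nseq.
under eq_bigr do rewrite !mE.
case: n => [|n]; first by rewrite semicircle_moment1 // big_ord0 mulr0.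
rewrite semicircle_moment_conv // rmorphM rmorph_sum; congr (_ * _).
by apply: eq_bigr => i _; rewrite rmorphM subSS.
Qed.

End Gamma.

Section Convolution.
Context (R : realType) (k : nat).

Lemma free_convolution_model (mu nu : Dalg R k) :
  exists (A : ncprob R) (x y : 'I_k -> A),
    [/\ has_joint_distribution x mu,
        has_joint_distribution y nu,
        freely_independent (fun b : bool => if b then range x else range y)
      & has_joint_distribution (fun i => x i + y i) (free_convolution mu nu)].
Proof.
apply: (@getPex _ [set rho | exists (A : ncprob R) (x y : 'I_k -> A),
    [/\ has_joint_distribution x mu,
        has_joint_distribution y nu,
        freely_independent (fun b : bool => if b then range x else range y)
      & has_joint_distribution (fun i => x i + y i) rho]]).
(* Both families share one alphabet: [c] tells the half in which a letter lies, [h] forgets it, and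
   [m] prescribes [mu] on one half and [nu] on the other. *)
pose c (l : 'I_(k + k)) := if fintype.split l is inl _ then true else false.
pose h (l : 'I_(k + k)) :=
  match fintype.split l with inl i => i | inr i => i end.
pose m (w : seq 'I_(k + k)) : R[i] :=
  (if all c w then mu else nu) (\prod_(l <- w) ncX (h l)).
have cl i : c (lshift k i) = true by rewrite /c (unsplitK (inl i)).
have cr i : c (rshift k i) = false by rewrite /c (unsplitK (inr i)).
have hl i : h (lshift k i) = i by rewrite /h (unsplitK (inl i)).
have hr i : h (rshift k i) = i by rewrite /h (unsplitK (inr i)).
have [|A [x [xm xf]]] := @word_free_model R _ (k + k) c m.
  by rewrite /m big_nil functional1.
have [|rho rhoE] := @Dalg_exists R k
    (word_moment (fun i => x (lshift k i) + x (rshift k i))).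
  exact: word_moment_nil.
exists rho, A, (fun i => x (lshift k i)), (fun i => x (rshift k i)); split=> //.
- move=> w; rewrite -(big_map (lshift k) xpredT x) -/(word_moment x _).
  have lw : all c (map (lshift k) w) by rewrite all_map; apply/allP => i _ /=.
  rewrite (xm true); last by apply: sub_all lw => l /= ->.
  by rewrite /m lw big_map; under [in RHS]eq_bigr do rewrite hl.
- move=> w; rewrite -(big_map (@rshift k k) xpredT x) -/(word_moment x _).
  rewrite (xm false); last first.
    by rewrite /monochrome all_map; apply/allP => i _ /=; rewrite cr.
  rewrite /m big_map; under [in RHS]eq_bigr do rewrite hr.
  case: w => [|i w]; first by rewrite !big_nil !functional1.
  by rewrite /= cr.
- apply: (word_free_freely_independent _ xf) => -[] b [i _ <-].
    by exists (lshift k i).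
  by exists (rshift k i).
Qed.

End Convolution.

Section Doubling.
Context (K : comNzRingType) (k : nat).
Local Notation L := ('I_k + 'I_k)%type.
Implicit Types (p q g : seq L -> K) (v : seq 'I_k).

(* The sum of g over all the ways of putting each letter of v in one of the two
   copies of the alphabet. *)
Fixpoint sum_lifts g v : K :=
  if v is j :: v' then sum_lifts (fun w => g (inl j :: w)) v' +
    sum_lifts (fun w => g (inr j :: w)) v'
  else g [::].

Lemma sum_liftsD g g' v :
  sum_lifts (fun w => g w + g' w) v = sum_lifts g v + sum_lifts g' v.
Proof. by elim: v g g' => //= j v IHv g g'; rewrite !IHv; ring. Qed.

Lemma sum_liftsZ a g v : sum_lifts (fun w => a * g w) v = a * sum_lifts g v.
Proof. by elim: v g => //= j v IHv g; rewrite !IHv; ring. Qed.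

(** The cut letter must be placed in the second copy, while the letters on its two sides are placed
    independently, so the sum over placements factors. *)
Lemma sum_lifts_split_sum j p q v :
  sum_lifts (split_sum (inr j) p q) v =
  split_sum j (sum_lifts p) (sum_lifts q) v.
Proof.
elim: v p => //= l v IHv p.
rewrite !sum_liftsD !sum_liftsZ !IHv split_sumD.
by rewrite mul0r add0r addrCA.
Qed.

End Doubling.

Section SemicircularConvolution.
Context (R : realType) (k : nat) (nu : Dalg R k) (t : R) (t0 : 0 < t).
Let sigma := free_convolution nu (gamma k t).

(** The witness [F u v] is phi of the x-word [u] times the (x+y)-word [v]. In the last clause the
    prefix [u] stays with the right factor of the split, so the left factor is [F [::]]. *)
Lemma convolution_gamma_schwinger_dyson :
  exists F : seq 'I_k -> seq 'I_k -> R[i],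
  [/\ forall u, F u [::] = nu (\prod_(i <- u) ncX i),
      forall v, F [::] v = sigma (\prod_(i <- v) ncX i)
    & forall u j v, F u (j :: v) =
        F (rcons u j) v + t%:C * split_sum j (F [::]) (F u) v].
Proof.
have [A [x [y [xd yd xyf sd]]]] := free_convolution_model nu (gamma k t).
pose z (l : 'I_k + 'I_k) := match l with inl i => x i | inr i => y i end.
pose c (l : 'I_k + 'I_k) := if l is inl _ then true else false.
pose f := word_moment z.
have fwf : word_free c f.
  by apply: (freely_independent_word_free _ xyf) => -[] i; exists i.
have z_inl u : \prod_(l <- map inl u) z l = \prod_(i <- u) x i.
  by rewrite big_map.
pose F u v := ncp_phi A (\prod_(i <- u) x i * \prod_(i <- v) (x i + y i)).
have phi_lifts b v : ncp_phi A (b * \prod_(i <- v) (x i + y i)) =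
    sum_lifts (fun w => ncp_phi A (b * \prod_(l <- w) z l)) v.
  elim: v b => [|j v IHv] b /=; first by rewrite !big_nil.
  rewrite big_cons mulrA mulrDr mulrDl linearD /= !IHv.
  by congr (_ + _); congr sum_lifts; apply/funext => w; rewrite big_cons mulrA.
have F_lifts u v : F u v = sum_lifts (fun w => f (map inl u ++ w)) v.
  rewrite /F phi_lifts; congr sum_lifts; apply/funext => w.
  by rewrite /f /word_moment big_cat z_inl.
have sd_y j u w : f (map inl u ++ inr j :: w) =
    t%:C * split_sum (inr j) f (fun v => f (map inl u ++ v)) w.
  apply: (word_schwinger_dyson (word_moment_nil z) fwf (j := true)) => //.
    move=> v vj.
    have -> : v =
        map inr (pmap (fun l => if l is inr i then Some i else None) v).
      by elim: v vj => //= -[] i v IHv //= /IHv {1}->.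
    move: (pmap _ v) => v'.
    have yw u' : f (map inr u') = gamma k t (\prod_(i <- u') ncX i).
      by rewrite yd /f /word_moment big_map.
    rewrite -/f -[inr j :: _]/(map inr (j :: v')) yw gamma_schwinger_dyson //.
    rewrite split_sum_map; last by move=> ? ? [].
    by congr (_ * split_sum _ _ _ _); apply/funext => u'; rewrite yw.
  by rewrite /monochrome all_map; apply/allP.
exists F; split.
- by move=> u; rewrite xd /F big_nil mulr1.
- by move=> v; rewrite sd /F big_nil mul1r.
move=> u j v.
rewrite {1}F_lifts /=; congr (_ + _).
  rewrite F_lifts; congr sum_lifts; apply/funext => w.
  by rewrite map_rcons cat_rcons.
rewrite (_ : (fun w => f (map inl u ++ inr j :: w)) = fun w =>
  t%:C * split_sum (inr j) f (fun v => f (map inl u ++ v)) w);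
  last exact/funext/sd_y.
rewrite sum_liftsZ sum_lifts_split_sum.
by congr (_ * split_sum _ _ _ _); apply/funext => w; rewrite F_lifts.
Qed.

Lemma convolution_gamma_subordination :
  let S := sandwich (1 + moment_series sigma) in
  (1 - t%:C *: S) * (1 + moment_series sigma) =
    ncsubst (1 + moment_series nu) (fun i => ncZ i * (1 - t%:C *: S)^-1).
Proof.
move=> S; set w := fun i => _.
have w0 i : nccoef (w i) [::] = 0 by rewrite nccoefM0 mul0r.
have aU : 1 - t%:C *: S \is a GRing.unit.
  by apply: ncs_unitrB; rewrite /= sandwich0 mulr0.
have [F [Fnu Fsigma FE]] := convolution_gamma_schwinger_dyson.
pose G u : ncseries R[i] k := NCSeries (F u).
have G0 : G [::] = 1 + moment_series sigma.
  by apply: ncseriesP => v; rewrite nccoef_moment -Fsigma.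
have GE u : G u = nu (\prod_(i <- u) ncX i) *: (1 : ncseries R[i] k) +
    \sum_j ncZ j * (G (rcons u j) + t%:C *: (G [::] * (ncZ j * G u))).
  rewrite {1}[G u]ncs_lderivE /= Fnu; congr (_ + _).
  apply: eq_bigr => j _; congr (_ * _); apply: ncseriesP => v.
  rewrite -[LHS]/(F u (j :: v)) FE.
  rewrite -[split_sum _ _ _ _]/(split_sum j (nccoef (G [::])) (nccoef (G u)) v).
  by rewrite -nccoef_split_sum.
pose H (u : seq 'I_k) : ncseries R[i] k :=
  NCSeries (fun v => nu (\prod_(i <- u ++ v) ncX i)).
have H0 : H [::] = 1 + moment_series nu.
  by apply: ncseriesP => v; rewrite nccoef_moment.
rewrite -G0 -H0.
(* The sum of the z_j G [::] z_j is [S], so [GE] gives (1 - t S) G u as a constant plus the sum of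
   the z_j G (rcons u j), and each z_j is w_j (1 - t S). The substituted quotients [H u] of 1 + M_nu
   along [u] solve the same system. *)
apply: (@lderiv_unique _ _ w w0 _ 
  (fun u => nu (\prod_(i <- u) ncX i)) (@rcons _)
  (fun u => (1 - t%:C *: S) * G u) (fun u => ncsubst (H u) w)) => u.
  have -> : (1 - t%:C *: S) * G u =
      nu (\prod_(i <- u) ncX i) *: (1 : ncseries R[i] k) +
      \sum_j ncZ j * G (rcons u j).
    rewrite mulrBl mul1r {1}GE; apply/eqP; rewrite subr_eq -addrA; apply/eqP.
    congr (_ + _); rewrite ncs_scaleAl mulr_suml scaler_sumr -big_split.
    by apply: eq_bigr => j _; rewrite /= mulrDr ncs_scaleAr G0 !mulrA.
  congr (_ + _).
  by apply: eq_bigr => j _; rewrite /w -mulrA (mulKr aU).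
rewrite (ncsubstE w0) /= cats0; congr (_ + _); apply: eq_bigr => j _.
by congr (_ * ncsubst _ _); apply: ncseriesP => v /=; rewrite cat_rcons.
Qed.

End SemicircularConvolution.

Theorem theorem6p2 (R : realType) (k : nat) (hk : (1 <= k)%N)
  (nu : Dalg R k) (t : R) (ht : 0 < t) :
  Phi (free_convolution nu (gamma k t)) = BB t (Phi nu).
Proof.
exact/esym/BB_Phi_subordination/convolution_gamma_subordination.
Qed.
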